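(* Let $b$ be a locally finite, connected graph over a discrete measure space $(X,m)$. Let $\inf\{m(x)\mid x\in X\}>0$ and let the weighted degree function $\mathrm{Deg}(x)=\frac{1}{m(x)}\sum_{y\in X}b(x,y)$ be bounded on $X$. Let the volume growth of the graph be at most polynomial of degree $\theta>0$. Let $p\in[1,\infty)$, and let $f:[0,\infty)\to[0,\infty)$ be convex and continuous on $[0,\infty)$ with $f(0)=0$, $f(s)>0$ for all $s>0$, and $\int_1^\infty\frac{1}{f(s)}\,ds<\infty$. Assume that there are constants $\kappa,\gamma>0$ such that the function $F$ defined by $F(t)=\int_t^\infty \frac{1}{f(s)}\,ds$ for $t>0$ satisfies $F(1/t)\le\kappa\,t^\gamma$ for all sufficiently large $t$. Suppose that $\theta\gamma<2$. Then for all nontrivial (i.e. not identically zero) initial values $a\in\ell^p_+(X,m)$ the system $$u'=-Lu+f(u),\qquad u(0)=a,\qquad u\ge0,$$ has no global $\ell^p(X,m)$-valued mild solution.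
   Context: Let $X$ be a countable set. A graph over $X$ is a map $b:X\times X\to[0,\infty)$ with $b(x,x)=0$ for all $x\in X$, $b(x,y)=b(y,x)$ for all $x,y\in X$, and $\sum_{y\in X}b(x,y)<\infty$ for all $x\in X$. Vertices $x,y$ are neighbours (adjacent) if $b(x,y)>0$. The graph is locally finite if every vertex has only finitely many neighbours. A path from $x$ to $y$ is a finite sequence $x_1=x,\dots,x_n=y$ of consecutively adjacent vertices, its length is $n-1$; the graph is connected if any two vertices are joined by a path, and then the combinatorial distance (shortest length of a path) is a metric on $X$. A discrete measure space $(X,m)$ is a countable set $X$ with a function $m:X\to(0,\infty)$, identified with the measure $m(A)=\sum_{x\in A}m(x)$; a graph over $(X,m)$ is a graph over $X$. $\ell^p(X,m)$ is the corresponding real $L^p$ space and $\ell^p_+(X,m)$ its subset of nonnegative functions. With $B_r(x)$ the closed ball of radius $r$ around $x$ in the combinatorial distance, the graph has at most polynomial volume growth of degree $\theta>0$ if there exist $x\in X$ and constants $D,r_0>0$ such that $m(B_r(x))\le D r^\theta$ for all $r>r_0$. When $\mathrm{Deg}$ is bounded, the operator $L$ given by $L\phi(x)=\frac{1}{m(x)}\sum_{y\in X}b(x,y)(\phi(x)-\phi(y))$ is a bounded linear operator on $\ell^p(X,m)$ (nonnegative when $p=2$), and $e^{-tL}=\sum_{k=0}^\infty\frac{(-tL)^k}{k!}$, $t\ge0$, is a strongly continuous sub-Markovian semigroup on $\ell^p(X,m)$ (i.e. $0\le\phi\le1$ implies $0\le e^{-tL}\phi\le1$). A global $\ell^p(X,m)$-valued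 mild solution of the system is a function $u:[0,\infty)\to\ell^p_+(X,m)$ such that $f\circ u(t)\in\ell^p(X,m)$ for all $t>0$, $f\circ u\in L^1((0,t];\ell^p(X,m))$ (Bochner integrable) for every $t>0$, and $u(t)=e^{-tL}a+\int_0^te^{-(t-s)L}f(u(s))\,ds$ (Bochner integral) for every $t\ge0$. *)

(* Defs.v *)
From HB Require Import structures.
From mathcomp Require Import all_boot all_order all_algebra.
From mathcomp Require Import all_classical all_reals all_analysis.
From mathcomp Require Import ring lra.

Set Implicit Arguments.
Unset Strict Implicit.
Unset Printing Implicit Defensive.

Import Order.TTheory GRing.Theory Num.Theory.
Import numFieldNormedType.Exports.

Local Open Scope classical_set_scope.
Local Open Scope ring_scope.

Record graph (R : realType) (X : countType) := Graph {
  weight :> X -> X -> R;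
  weight_ge0 : forall x y, 0 <= weight x y;
  weight_xx : forall x, weight x x = 0;
  weightC : forall x y, weight x y = weight y x;
  weight_summable : forall x, (\esum_(y in [set: X]) (weight x y)%:E < +oo)%E
}.

Section Graphs.
Context {R : realType} {X : countType}.
Implicit Types (b : graph R X) (m : X -> {posnum R}).

Definition adjacent b : rel X := fun x y => 0 < b x y.

Definition locally_finite b :=
  forall x, finite_set [set y | adjacent b x y].

(* `x :: s` is the sequence of vertices of the path, so its length is `size s` *)
Definition joined_by b (x y : X) (s : seq X) :=
  path (adjacent b) x s /\ last x s = y.

Definition connected_graph b := forall x y, exists s, joined_by b x y s.

(* 0 if there is no path from x to y *)
Definition comb_dist b (x y : X) : nat :=
  if pselect (exists n, `[< exists s, joined_by b x y s /\ size s = n >])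
    is left path_xy then ex_minn path_xy else 0%N.

Definition comb_ball b (x : X) (r : R) := [set y | (comb_dist b x y)%:R <= r].

Definition vertex_measure m (A : set X) : \bar R :=
  \esum_(x in A) ((m x)%:num)%:E.

Definition polynomial_growth b m (theta : R) :=
  exists (x : X) (D r0 : R), [/\ 0 < D, 0 < r0 &
    forall r, r0 < r ->
      (vertex_measure m (comb_ball b x r) <= (D * r `^ theta)%:E)%E].

(* The sums over all y in `deg` and `laplacian` have finite support on a
   locally finite graph, the only case in which they are used; `\sum_(y \in _)`
   would return 0 on an infinite support. *)
Definition deg b m (x : X) : R :=
  ((m x)%:num)^-1 * \sum_(y \in [set: X]) b x y.

Definition laplacian b m (phi : X -> R) (x : X) : R :=
  ((m x)%:num)^-1 * \sum_(y \in [set: X]) b x y * (phi x - phi y).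

End Graphs.

Section EllpNorm.
Context {R : realType} {X : countType}.
Variables (m : X -> {posnum R}) (p : R).
Implicit Types (phi psi : X -> R).

Definition psum phi : \bar R :=
  \esum_(x in [set: X]) (`|phi x| `^ p * (m x)%:num)%:E.

Definition ellp_norm phi : R := fine (psum phi) `^ p^-1.

Definition ellp_pred : {pred X -> R} := fun phi => (psum phi < +oo)%E.

Lemma psum_term_ge0 phi x : 0 <= `|phi x| `^ p * (m x)%:num.
Proof. by rewrite mulr_ge0// powR_ge0. Qed.

Lemma psum_ge0 phi : (0 <= psum phi)%E.
Proof. by apply: esum_ge0 => x _; rewrite lee_fin psum_term_ge0. Qed.

Lemma fine_psumK phi : phi \in ellp_pred -> (fine (psum phi))%:E = psum phi.
Proof. by move=> h; rewrite fineK// ge0_fin_numE ?psum_ge0. Qed.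

Lemma fine_psum_ge0 phi : 0 <= fine (psum phi).
Proof. by rewrite fine_ge0// psum_ge0. Qed.

Lemma esumZ_le (c : R) (a : X -> R) : 0 <= c -> (forall x, 0 <= a x) ->
  (\esum_(x in [set: X]) (c * a x)%:E
    <= c%:E * \esum_(x in [set: X]) (a x)%:E)%E.
Proof.
move=> c0 a0; apply: ge_ereal_sup => _ [A finA <-].
rewrite (eq_fsbigr (fun x => c%:E * (a x)%:E)%E)//.
rewrite -ge0_mule_fsumr; last by move=> x; rewrite lee_fin.
by rewrite lee_wpmul2l ?lee_fin//; apply: ereal_sup_ubound; exists A.
Qed.

Hypothesis p1 : 1 <= p.

Let p0 : 0 < p. Proof. exact: lt_le_trans p1. Qed.

Lemma psumZ_le (c : R) phi : (psum (c *: phi)%R <= (`|c| `^ p)%:E * psum phi)%E.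
Proof.
apply: (le_trans _ (esumZ_le (powR_ge0 _ _) (psum_term_ge0 _))).
apply: le_esum => x _.
by rewrite lee_fin mulrA -powRM// -normrM.
Qed.

Lemma psum0 : psum (0 : X -> R) = 0%E.
Proof.
by apply: esum1 => x _; rewrite /= normr0 powR0 ?mul0r ?gt_eqF.
Qed.

Lemma psum_eq0 phi : psum phi = 0%E -> phi = 0.
Proof.
move=> h; apply/funext => x.
have : ((`|phi x| `^ p * (m x)%:num)%:E <= psum phi)%E.
  apply: esum_ge; exists [set x]; first by split => //; exact: finite_set1.
  by rewrite fsbig_set1.
rewrite h lee_fin => h'.
have : `|phi x| `^ p * (m x)%:num = 0.
  by apply/eqP; rewrite eq_le h' psum_term_ge0.
move/eqP; rewrite mulf_eq0 (gt_eqF (gt0 (m x))) orbF powR_eq0.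
by rewrite normr_eq0 => /andP[/eqP].
Qed.

Lemma psum_conv (t : R) phi psi : 0 <= t -> t <= 1 ->
  (psum (t *: phi + (1 - t) *: psi)%R
    <= t%:E * psum phi + (1 - t)%R%:E * psum psi)%E.
Proof.
move=> t0 t1; have t1' : 0 <= 1 - t by rewrite subr_ge0.
apply: (le_trans _ (leeD (esumZ_le t0 (psum_term_ge0 phi))
                         (esumZ_le t1' (psum_term_ge0 psi)))).
rewrite -esumD; last 2 first.
- by move=> x _; rewrite lee_fin mulr_ge0 ?psum_term_ge0.
- by move=> x _; rewrite lee_fin mulr_ge0 ?psum_term_ge0.
apply: le_esum => x _; rewrite -EFinD lee_fin !mulrA -mulrDl ler_wpM2r//.
have := @convex_powR R p p1 (Itv01 t0 t1) `|phi x| `|psi x|.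
rewrite !inE/= !in_itv/= !normr_ge0 => /(_ isT isT).
rewrite !convRE/= /unstable.onem; apply: le_trans.
apply: ge0_ler_powR; rewrite ?nnegrE ?addr_ge0 ?mulr_ge0//.
  exact: ltW.
by rewrite (le_trans (ler_normD _ _))// !normrM (ger0_norm t0) (ger0_norm t1').
Qed.

Lemma ellp_predZ (c : R) phi : phi \in ellp_pred -> c *: phi \in ellp_pred.
Proof.
move=> h; apply: (le_lt_trans (psumZ_le c phi)).
by rewrite -fine_psumK// -EFinM ltry.
Qed.

Lemma ellp_predD phi psi :
  phi \in ellp_pred -> psi \in ellp_pred -> phi + psi \in ellp_pred.
Proof.
move=> h1 h2.
have -> : phi + psi = 2 *: (2^-1 *: phi + (1 - 2^-1) *: psi).
  have -> : (1 - 2^-1 : R) = 2^-1 by lra.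
  by rewrite -scalerDr scalerA mulfV ?scale1r.
have half0 : 0 <= 2^-1 :> R by lra.
have half1 : 2^-1 <= 1 :> R by lra.
apply: ellp_predZ; apply: (le_lt_trans (psum_conv _ _ half0 half1)).
by rewrite -fine_psumK// -[psum psi]fine_psumK// -!EFinM -EFinD ltry.
Qed.

Lemma ellp_submod_closed : submod_closed ellp_pred.
Proof.
split; first by rewrite unfold_in psum0 ltry.
by move=> a phi psi h1 h2; apply: ellp_predD => //; exact: ellp_predZ.
Qed.

Lemma ellp_normZ_le (c : R) phi : phi \in ellp_pred ->
  ellp_norm (c *: phi) <= `|c| * ellp_norm phi.
Proof.
move=> h; rewrite /ellp_norm.
have -> : `|c| = (`|c| `^ p) `^ p^-1.
  by rewrite -powRrM mulfV ?gt_eqF// powRr1.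
rewrite -powRM ?powR_ge0 ?fine_psum_ge0//.
apply: ge0_ler_powR; rewrite ?nnegrE ?invr_ge0 ?fine_psum_ge0 ?(ltW p0)//.
  by rewrite mulr_ge0 ?powR_ge0 ?fine_psum_ge0.
by rewrite -lee_fin EFinM !fine_psumK ?psumZ_le// ellp_predZ.
Qed.

Lemma ellp_normZ (c : R) phi : phi \in ellp_pred ->
  ellp_norm (c *: phi) = `|c| * ellp_norm phi.
Proof.
move=> h; apply/eqP; rewrite eq_le ellp_normZ_le//=.
have [->|c0] := eqVneq c 0; first by rewrite normr0 mul0r powR_ge0.
rewrite -ler_pdivlMl ?normr_gt0// -normfV.
rewrite -{1}[phi]scale1r -(mulVf c0) -scalerA.
by apply: ellp_normZ_le; exact: ellp_predZ.
Qed.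

Lemma ellp_norm_eq0 phi : phi \in ellp_pred -> ellp_norm phi = 0 -> phi = 0.
Proof.
move=> h /eqP; rewrite powR_eq0 => /andP[/eqP h0 _].
by apply: psum_eq0; rewrite -fine_psumK// h0.
Qed.

Lemma ellp_normX phi : ellp_norm phi `^ p = fine (psum phi).
Proof. by rewrite -powRrM mulVf ?gt_eqF// powRr1// fine_psum_ge0. Qed.

Lemma ellp_norm_le1 phi : phi \in ellp_pred ->
  (ellp_norm phi <= 1) = (psum phi <= 1)%E.
Proof.
move=> h; rewrite -fine_psumK// lee_fin -ellp_normX.
have p1E : 1 `^ p = 1 :> R by rewrite powR1.
apply/idP/idP => [le1|].
  by rewrite -p1E ge0_ler_powR ?nnegrE ?powR_ge0 ?(ltW p0).
move=> le1; rewrite leNgt; apply/negP => gt1.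
suff : 1 < ellp_norm phi `^ p by rewrite ltNge le1.
by rewrite -{1}p1E gt0_ltr_powR ?nnegrE ?powR_ge0.
Qed.

Lemma ellp_normD phi psi : phi \in ellp_pred -> psi \in ellp_pred ->
  ellp_norm (phi + psi) <= ellp_norm phi + ellp_norm psi.
Proof.
move=> h1 h2.
have [z1|nz1] := eqVneq (ellp_norm phi) 0.
  by rewrite (ellp_norm_eq0 h1 z1) add0r lerDr powR_ge0.
have [z2|nz2] := eqVneq (ellp_norm psi) 0.
  by rewrite (ellp_norm_eq0 h2 z2) addr0 lerDl powR_ge0.
have a0 : 0 < ellp_norm phi by rewrite lt0r nz1 powR_ge0.
have c0 : 0 < ellp_norm psi by rewrite lt0r nz2 powR_ge0.
move: nz1 nz2 a0 c0; move Ea : (ellp_norm phi) => a; move Ec : (ellp_norm psi) => c.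
move=> nz1 nz2 a0 c0.
have ac0 : 0 < a + c by exact: (addr_gt0 a0 c0).
have h1' := ellp_predZ a^-1 h1; have h2' := ellp_predZ c^-1 h2.
have n1 : (psum (a^-1 *: phi)%R <= 1)%E.
  by rewrite -(ellp_norm_le1 h1') (ellp_normZ _ h1) Ea gtr0_norm ?invr_gt0// mulVf.
have n2 : (psum (c^-1 *: psi)%R <= 1)%E.
  by rewrite -(ellp_norm_le1 h2') (ellp_normZ _ h2) Ec gtr0_norm ?invr_gt0// mulVf.
pose t := a / (a + c).
have t0 : 0 <= t by rewrite divr_ge0 ?ltW.
have t1 : t <= 1 by rewrite ler_pdivrMr// mul1r lerDl ltW.
have tE : 1 - t = c / (a + c) by rewrite /t; field; rewrite gt_eqF.
have E : phi + psi
    = (a + c) *: (t *: (a^-1 *: phi) + (1 - t) *: (c^-1 *: psi)).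
  rewrite tE scalerDr !scalerA /t.
  have -> : (a + c) * (a / (a + c)) * a^-1 = 1.
    by field; rewrite nz1 gt_eqF.
  have -> : (a + c) * (c / (a + c)) * c^-1 = 1.
    by field; rewrite nz2 gt_eqF.
  by rewrite !scale1r.
have hm : t *: (a^-1 *: phi) + (1 - t) *: (c^-1 *: psi) \in ellp_pred.
  by apply: ellp_predD; exact: ellp_predZ.
rewrite E (ellp_normZ _ hm) gtr0_norm// ger_pMr// (ellp_norm_le1 hm).
apply: (le_trans (psum_conv _ _ t0 t1)).
apply: (@le_trans _ _ (t%:E * 1 + (1 - t)%R%:E * 1)%E).
  by apply: leeD; apply: lee_wpmul2l => //; rewrite lee_fin ?subr_ge0.
by rewrite !mule1 -EFinD addrC subrK.
Qed.

End EllpNorm.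

Record ellp (R : realType) (X : countType) (m : X -> {posnum R}) (p : R)
    (p1 : 1 <= p) := Ellp {
  ellp_fun :> X -> R;
  ellp_funP : ellp_fun \in ellp_pred m p
}.

Section EllpSpace.
Context {R : realType} {X : countType}.
Variables (m : X -> {posnum R}) (p : R) (p1 : 1 <= p).

HB.instance Definition _ := GRing.isSubmodClosed.Build R (X -> R)
  (ellp_pred m p) (ellp_submod_closed m p1).

HB.instance Definition _ := [isSub for @ellp_fun R X m p p1].
HB.instance Definition _ := [Choice of ellp m p1 by <:].
HB.instance Definition _ := [SubChoice_isSubLmodule of ellp m p1 by <:].

Let norm (phi : ellp m p1) : R := ellp_norm m p phi.

Let norm_triangle (phi psi : ellp m p1) :
  norm (phi + psi) <= norm phi + norm psi.
Proof. exact: (ellp_normD p1 (ellp_funP phi) (ellp_funP psi)). Qed.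

Let norm_scale (c : R) (phi : ellp m p1) : norm (c *: phi) = `|c| * norm phi.
Proof. exact: (ellp_normZ p1 c (ellp_funP phi)). Qed.

Let norm_definite (phi : ellp m p1) : norm phi = 0 -> phi = 0.
Proof.
by move=> h; apply/val_inj; exact: (ellp_norm_eq0 (ellp_funP phi) h).
Qed.

HB.instance Definition _ := @Lmodule_isNormed.Build R (ellp m p1) norm
  norm_triangle norm_scale norm_definite.

Lemma ellp_normE (phi : ellp m p1) : `|phi| = ellp_norm m p phi.
Proof. by []. Qed.

End EllpSpace.

Section BochnerIntegral.
Context d (T : measurableType d) (R : realType).
Variables (mu : {measure set T -> \bar R}) (V : normedModType R).
Implicit Types (D : set T) (g : T -> V).
Local Open Scope ereal_scope.

Definition integrable_simple D (s : T -> V) :=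
  [/\ finite_set (range s),
      forall v, measurable (D `&` s @^-1` [set v]) &
      forall v, v != 0%R -> mu (D `&` s @^-1` [set v]) < +oo].

Definition simple_integral D (s : T -> V) : V :=
  (\sum_(v \in range s) fine (mu (D `&` s @^-1` [set v])) *: v)%R.

Definition bochner_approx D g (s : nat -> T -> V) :=
  [/\ forall n, integrable_simple D (s n),
      {ae mu, forall x, D x -> s n x @[n --> \oo] --> g x} &
      \int[mu]_(x in D) `|g x - s n x|%R%:E @[n --> \oo] --> 0].

Definition bochner_integrable D g := exists s, bochner_approx D g s.

Definition is_bochner_integral D g (v : V) := exists s,
  bochner_approx D g s /\ simple_integral D (s n) @[n --> \oo] --> v.

End BochnerIntegral.

Section MildSolutions.
Context {R : realType} {X : countType}.
Variables (m : X -> {posnum R}) (p : R) (p1 : 1 <= p) (b : graph R X).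

(* g as an element of l^p(X, m), and 0 if g is not in l^p(X, m) *)
Definition to_ellp (g : X -> R) : ellp m p1 := insubd 0 g.

(* `to_ellp` is harmless here: if `deg b m` is bounded, then the Laplacian of a
   function in l^p(X, m) is in l^p(X, m). *)
Definition lap_op (phi : ellp m p1) : ellp m p1 := to_ellp (laplacian b m phi).

(* exp(- t L) phi, the limit being taken in l^p(X, m) *)
Definition heat (t : R) (phi : ellp m p1) : ellp m p1 :=
  limn (series (fun k => ((- t) ^+ k / k`!%:R) *: iter k lap_op phi)).

(* Only the values of u on [0, +oo[ matter. *)
Definition global_mild_solution (f : R -> R) (a : ellp m p1)
    (u : R -> ellp m p1) :=
  [/\ forall t, 0 <= t -> forall x, 0 <= u t x,
      forall t, 0 < t -> f \o u t \in ellp_pred m p,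
      forall t, 0 < t -> bochner_integrable lebesgue_measure `]0, t]
        (fun s => to_ellp (f \o u s)) &
      forall t, 0 <= t -> exists2 v : ellp m p1,
        is_bochner_integral lebesgue_measure `]0, t]
          (fun s => heat (t - s) (to_ellp (f \o u s))) v &
        u t = heat t a + v].

End MildSolutions.

Definition tail_integral {R : realType} (f : R -> R) (t : R) : \bar R :=
  (\int[lebesgue_measure]_(s in `[t, +oo[) ((f s)^-1)%:E)%E.

(* Main.v *)
Require Import Defs.
From HB Require Import structures.
From mathcomp Require Import all_boot all_order all_algebra.
From mathcomp Require Import finmap zify ring lra.
From mathcomp Require Import all_classical all_reals all_analysis.
From mathcomp Require Import measurable_realfun.

Set Implicit Arguments.
Unset Strict Implicit.
Unset Printing Implicit Defensive.

Import Order.TTheory GRing.Theory Num.Theory.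
Import numFieldNormedType.Exports.

Local Open Scope classical_set_scope.
Local Open Scope ring_scope.

(** Write [L] for the Laplacian and fix a vertex [o] with [a o > 0].

    Let [u] be a global mild solution and fix a time [T].  By the semigroup law, [V s = (exp (- (T - s) L) (u s)) o] satisfies
    [V s = (exp (- T L) a) o + int_0^s (exp (- (T - r) L) f (u r)) o dr], and by
    Jensen's inequality the integrand is at least [f (V r)].  So [V] is a
    supersolution of [V' = f V] that lives on [[0, T]], which forces
    [T <= F ((exp (- T L) a) o)] ([mild_solution_lifetime], which rests on
    [bochner_functional] and [lifetime_le_tail_integral]).  If moreover
    [(exp (- T L) a) o >= c T ^ (- theta' / 2)] along a sequence of times going to
    infinity, then [T <= kappa c' T ^ (theta' gamma / 2)], which is absurd as soon
    as [theta' gamma < 2].  As the inequality [theta gamma < 2] is strict,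
    [theta' > theta] may be taken close to [theta].

    If [C >= 2 deg], then [L = C (1 - Q)] with [Q] the Markov operator of a
    reversible walk that stays put with probability at least [1/2], whence
    [exp (- t L) = exp (- C t) sum_k (C t) ^ k / k! Q ^ k] ([heat_poisson]).  Thus
    positivity, Jensen's inequality and lower bounds follow from those of [Q],
    where all the sums are finite by local finiteness.  The convergence of the
    exponential series in [l^p] needs the completeness of [l^p] and the
    contractivity of [Q] ([ellp_cauchy_cvg], [psum_walk_le]).

    For the heat kernel bound, let [h] be the density of the walk after [j <= 2 N]
    steps from [o] and let [d] be the distance to the centre of the balls of
    polynomial growth.  Weighting by [(1 + eta) ^ d] with [eta = N ^ (- 1/2)] only
    increases the [l^2] energy of [h] by a bounded factor
    ([walk_weighted_energy]), so that, up to half of its mass, the walk stays in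
    the ball of radius [r], for [r] slightly larger than [N ^ (1/2)]: there the
    weight [(1 + eta) ^ r] beats the polynomial volume of the range of the walk.
    By Cauchy-Schwarz the return probability, which is the energy of [h], is at
    least a constant times the inverse of the volume of that ball, hence at least
    [c r ^ (- theta)] ([walk_kernel_diag_ge], [walk_kernel_ge]).  Averaging over
    the Poisson time transfers this bound to the semigroup ([poisson_avg_ge]).
    The choice [N = n ^ (2 l)], [r = s n ^ (l + 1)] with natural numbers [l] and
    [s] makes [theta' = theta (l + 1) / l]. *)

Local Notation adjacent := Defs.adjacent.

(** * Convexity and finite sums *)

Lemma convex_function_ineq (R : realType) (f : R -> R) :
  convex_function (`[0, +oo[%classic : set R^o) f ->
  forall t x y, 0 <= t -> t <= 1 -> 0 <= x -> 0 <= y ->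
    f (t * x + (1 - t) * y) <= t * f x + (1 - t) * f y.
Proof.
move=> cf t x y t0 t1 x0 y0.
have := cf (Itv01 t0 t1) x y.
by rewrite !inE/= !in_itv/= x0 y0 => /(_ isT isT).
Qed.

Lemma convex_slopes (R : realType) (f : R -> R) :
  convex_function (`[0, +oo[%classic : set R^o) f ->
  forall x y z, 0 <= x -> x < y -> y < z ->
    (f y - f x) / (y - x) <= (f z - f y) / (z - y).
Proof.
move=> cf x y z x0 xy yz.
have yx : 0 < y - x by rewrite subr_gt0.
have zy : 0 < z - y by rewrite subr_gt0.
have zx : 0 < z - x by lra.
pose t := (z - y) / (z - x).
have tE : t * x + (1 - t) * z = y by rewrite /t; field; lra.
have := convex_function_ineq cf (t := t) (x := x) (y := z).
rewrite tE => /(_ _ _ x0 _); rewrite /t divr_ge0 ?(ltW zy, ltW zx)//.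
rewrite ler_pdivrMr// mul1r => /(_ isT); rewrite lerD2l lerN2.
move=> /(_ (ltW xy)) /(_ (le_trans x0 (ltW (lt_trans xy yz)))) h.
rewrite ler_pdivrMr// mulrAC ler_pdivlMr//.
have {h} : f y * (z - x) <= (z - y) * f x + (y - x) * f z.
  rewrite -ler_pdivlMr//; apply: (le_trans h); rewrite le_eqVlt; apply/orP; left.
  by apply/eqP; field; lra.
lra.
Qed.

(** Jensen's inequality for any positive unital functional is this lemma
    integrated; the slope is the supremum of the slopes on the left of [z0]. *)
Lemma supporting_line (R : realType) (f : R -> R) :
  convex_function (`[0, +oo[%classic : set R^o) f ->
  (forall s, 0 <= s -> 0 <= f s) -> f 0 = 0 ->
  forall z0, 0 <= z0 -> exists c, forall z, 0 <= z ->
    f z0 + c * (z - z0) <= f z.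
Proof.
move=> cf f0 f00 z0; rewrite le_eqVlt => /predU1P[<-|z0p].
  by exists 0 => z z_ge0; rewrite f00 mul0r addr0 f0.
pose S := [set (f z0 - f x) / (z0 - x) | x in [set x | 0 <= x < z0]].
have S0 : S ((f z0 - f 0) / (z0 - 0)) by exists 0 => //=; rewrite lexx.
have ubS : forall z, z0 < z -> ubound S ((f z - f z0) / (z - z0)).
  by move=> z zz0 _ [x /= /andP[x0 xz0] <-]; exact: convex_slopes.
have hS : has_sup S.
  by split; [eexists; exact: S0|exists ((f (z0 + 1) - f z0) / (z0 + 1 - z0)); apply: ubS; lra].
exists (sup S) => z z_ge0; case: (ltgtP z z0) => [zz0|zz0|->]; last by lra.
- have /(ub_le_sup (proj2 hS)) : S ((f z0 - f z) / (z0 - z)).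
    by exists z => //=; rewrite z_ge0.
  by rewrite ler_pdivrMr ?subr_gt0//; lra.
- have : sup S <= (f z - f z0) / (z - z0).
    by apply: ge_sup; [eexists; exact: S0|exact: ubS].
  by rewrite ler_pdivlMr ?subr_gt0//; lra.
Qed.

Lemma convex_nondecreasing (R : realType) (f : R -> R) :
  convex_function (`[0, +oo[%classic : set R^o) f ->
  (forall s, 0 <= s -> 0 <= f s) -> f 0 = 0 ->
  forall x y, 0 <= x -> x <= y -> f x <= f y.
Proof.
move=> cf f0 f00 x y x0; rewrite le_eqVlt => /predU1P[->//|xy].
have y0 : 0 < y by exact: le_lt_trans xy.
have t1 : x / y <= 1 by rewrite ler_pdivrMr// mul1r ltW.
have t0 : 0 <= x / y by rewrite divr_ge0// ltW.
have := convex_function_ineq cf t0 t1 (ltW y0) (lexx 0).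
rewrite f00 !mulr0 !addr0 divfK ?gt_eqF// => /le_trans; apply.
by apply: ler_piMl => //; rewrite f0// ltW.
Qed.

Lemma cauchy_schwarz_sum (R : realType) (I : Type) (r : seq I)
    (w a b : I -> R) : (forall i, 0 <= w i) ->
  (\sum_(i <- r) w i * (a i * b i)) ^+ 2
    <= (\sum_(i <- r) w i * a i ^+ 2) * (\sum_(i <- r) w i * b i ^+ 2).
Proof.
move=> w0; set A := \sum_(i <- r) w i * a i ^+ 2.
set B := \sum_(i <- r) w i * b i ^+ 2.
set S := \sum_(i <- r) w i * (a i * b i).
have B0 : 0 <= B by apply: sumr_ge0 => i _; rewrite mulr_ge0 ?sqr_ge0.
have A0 : 0 <= A by apply: sumr_ge0 => i _; rewrite mulr_ge0 ?sqr_ge0.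
have key x y : 0 <= x ^+ 2 * A - 2 * x * y * S + y ^+ 2 * B.
  have -> : x ^+ 2 * A - 2 * x * y * S + y ^+ 2 * B
      = \sum_(i <- r) w i * (x * a i - y * b i) ^+ 2.
    rewrite /A /B /S !mulr_sumr -sumrB -big_split/=.
    by apply: eq_bigr => i _; ring.
  by apply: sumr_ge0 => i _; rewrite mulr_ge0 ?sqr_ge0.
have := key B S; have [B0'|Bn0] := eqVneq B 0; last first.
  have Bp : 0 < B by rewrite lt0r Bn0.
  have -> : B ^+ 2 * A - 2 * B * S * S + S ^+ 2 * B = B * (A * B - S ^+ 2) by ring.
  by rewrite pmulr_rge0// subr_ge0.
move=> _; have := key S (A + 1); rewrite B0' !mulr0 addr0 => h.
have : S ^+ 2 * (A + 2) <= 0 by lra.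
by rewrite pmulr_lle0//; lra.
Qed.

(** * Poisson averages of real sequences *)

Section Poisson.
Context {R : realType}.
Implicit Types (s t l : R) (z : R ^nat) (K : R).

Local Notation ec := (@exp_coeff R).

Lemma normr_exp_coeff t k : `|ec t k| = ec `|t| k.
Proof. by rewrite /exp_coeff /= normrM normfV normrX [ `|_%:R|]ger0_norm. Qed.

Lemma exp_coeff_nneg t k : 0 <= t -> 0 <= ec t k.
Proof. by move=> t0; rewrite /exp_coeff /= divr_ge0 ?exprn_ge0. Qed.

Lemma exp_coeffD s t k :
  ec (s + t) k = \sum_(0 <= i < k.+1) ec s i * ec t (k - i)%N.
Proof.
rewrite /exp_coeff /= addrC exprDn big_mkord mulr_suml.
apply: eq_bigr => i _; have ik : (i <= k)%N by rewrite -ltnS.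
have nz n : n`!%:R != 0 :> R by rewrite pnatr_eq0 -lt0n fact_gt0.
have : 'C(k, i)%:R * (i`!%:R * (k - i)`!%:R) = k`!%:R :> R.
  by rewrite -!natrM bin_fact.
move=> <-; rewrite -mulr_natr; field.
by rewrite !nz pnatr_eq0 -lt0n bin_gt0 ik.
Qed.

Lemma series_exp_coeff_le t n : 0 <= t -> series (ec t) n <= expR t.
Proof.
move=> t0; apply: nondecreasing_cvgn_le; last exact: is_cvg_series_exp_coeff.
by apply: nondecreasing_series => k _ _; exact: exp_coeff_nneg.
Qed.

Definition exp_series t z : R ^nat := series (fun k => ec t k * z k).

(** The mean of [z k] when [k] has the Poisson distribution of parameter [l]. *)
Definition poisson_avg l z : R := expR (- l) * limn (exp_series l z).

Lemma is_cvg_exp_series t z K : (forall k, `|z k| <= K) ->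
  cvgn (exp_series t z).
Proof.
move=> zK; have K0 : 0 <= K by exact: le_trans (zK 0%N).
apply: normed_cvg; apply: (@series_le_cvg _ _ (fun k => K * ec `|t| k)).
- by move=> n; exact: normr_ge0.
- by move=> n; rewrite mulr_ge0// exp_coeff_nneg.
- by move=> n; rewrite /= normrM normr_exp_coeff mulrC ler_wpM2r// exp_coeff_nneg.
- rewrite (_ : (fun k => _) = K *: ec `|t|)//.
  by apply: is_cvg_seriesZ; exact: is_cvg_series_exp_coeff.
Qed.

Lemma exp_series_tail t z K n : (forall k, `|z k| <= K) ->
  `|limn (exp_series t z) - exp_series t z n|
    <= K * (expR `|t| - series (ec `|t|) n).
Proof.
move=> zK; have K0 : 0 <= K by exact: le_trans (zK 0%N).
have h : `|exp_series t z k - exp_series t z n| @[k --> \oo]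
    --> `|limn (exp_series t z) - exp_series t z n|.
  have hc := @is_cvg_exp_series t z K zK.
  by apply: cvg_norm; apply: cvgB; [exact: hc|exact: cvg_cst].
apply: (cvgr_to_le h); near=> k.
have nk : (n <= k)%N by near: k; exact: nbhs_infty_ge.
rewrite /exp_series !seriesEnat /= (big_cat_nat _ nk)//= addrAC subrr add0r.
apply: (le_trans (ler_norm_sum _ _ _)).
apply: (@le_trans _ _ (K * \sum_(n <= i < k) ec `|t| i)).
  rewrite mulr_sumr; apply: ler_sum => i _.
  by rewrite normrM normr_exp_coeff mulrC ler_wpM2r// exp_coeff_nneg.
apply: ler_wpM2l => //; rewrite lerBrDl.
have -> : \sum_(0 <= k0 < n) ec `|t| k0 + \sum_(n <= i < k) ec `|t| i
    = series (ec `|t|) k by rewrite seriesEnat /= -big_cat_nat.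
exact: series_exp_coeff_le.
Unshelve. all: by end_near. Qed.

Lemma triangle_sum (F : nat -> nat -> R) n :
  \sum_(0 <= k < n) \sum_(0 <= i < k.+1) F i (k - i)%N
  = \sum_(0 <= i < n) \sum_(0 <= j < n - i) F i j.
Proof.
elim: n => [|n IH]; first by rewrite !big_nil.
rewrite big_nat_recr//= IH [RHS]big_nat_recr//= subSnn big_nat1.
rewrite [X in _ + X]big_nat_recr//= subnn addrA; congr (_ + _).
rewrite -big_split/= !big_nat; apply: eq_bigr => i /= i_n.
by rewrite subSn 1?ltnW// big_nat_recr.
Qed.

(** A Cauchy product: the terms of a bounded double sequence summed row by row
    and along the antidiagonals differ, up to order [n], by at most
    [K * (E_n s * exp t - E_n (s + t))] with [E_n] the partial sums of the
    exponential series. *)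
Lemma cauchy_product s t (c : nat -> nat -> R) K :
  (forall i j, `|c i j| <= K) ->
  exp_series s (fun i => limn (exp_series t (c i))) n
    - \sum_(0 <= k < n) \sum_(0 <= i < k.+1) ec s i * ec t (k - i)%N * c i (k - i)%N
    @[n --> \oo] --> 0.
Proof.
move=> cK; have K0 : 0 <= K by exact: le_trans (cK 0%N 0%N).
set T := fun n : nat => _ - _.
have bnd n : `|T n| <= K * (series (ec `|s|) n * expR `|t|
    - series (ec (`|s| + `|t|)) n).
  rewrite /T (triangle_sum (fun i j => ec s i * ec t j * c i j)).
  rewrite /exp_series seriesEnat /= -sumrB.
  apply: (le_trans (ler_norm_sum _ _ _)).
  have -> : series (ec (`|s| + `|t|)) n
      = \sum_(0 <= i < n) \sum_(0 <= j < n - i) ec `|s| i * ec `|t| j.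
    rewrite seriesEnat /= -triangle_sum; apply: eq_bigr => k _.
    exact: exp_coeffD.
  rewrite seriesEnat /= mulr_suml -sumrB mulr_sumr; apply: ler_sum => i _.
  have -> : \sum_(0 <= j < n - i) ec s i * ec t j * c i j
      = ec s i * exp_series t (c i) (n - i)%N.
    by rewrite /exp_series seriesEnat /= mulr_sumr; apply: eq_bigr => j _; rewrite mulrA.
  rewrite -mulrBr normrM normr_exp_coeff -mulr_sumr -mulrBr mulrCA.
  apply: ler_wpM2l; first exact: exp_coeff_nneg.
  by have := exp_series_tail t (n - i) (cK i); rewrite seriesEnat.
have lim0 : K * (series (ec `|s|) n * expR `|t| - series (ec (`|s| + `|t|)) n)
    @[n --> \oo] --> 0.
  have -> : 0 = K * (expR `|s| * expR `|t| - expR (`|s| + `|t|)).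
    by rewrite expRD subrr mulr0.
  apply: cvgM; first exact: cvg_cst.
  apply: cvgB; last exact: is_cvg_series_exp_coeff.
  by apply: cvgM; [exact: is_cvg_series_exp_coeff|exact: cvg_cst].
apply/cvgr0Pnorm_lt => e e0; move/cvgr0Pnorm_lt : lim0 => /(_ e e0).
apply: filterS => n; apply: le_lt_trans; apply: le_trans (bnd n) _.
exact: ler_norm.
Qed.

(** The semigroup law [exp (s Q) exp (t Q) = exp ((s + t) Q)] for a linear operator
    [Q], read on the sequence [z k = (Q ^ k phi) x]: a sum of independent Poisson
    variables is a Poisson variable. *)
Lemma poisson_avgD s t z K : (forall k, `|z k| <= K) ->
  poisson_avg (s + t) z
    = poisson_avg s (fun i => poisson_avg t (fun j => z (i + j)%N)).
Proof.
move=> zK; set w := fun i => limn (exp_series t (fun j => z (i + j)%N)).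
have wK i : `|w i| <= K * expR `|t|.
  have := exp_series_tail t 0 (fun j => zK (i + j)%N).
  by rewrite /exp_series !seriesEnat /= !big_nil !subr0.
have -> : poisson_avg s (fun i => poisson_avg t (fun j => z (i + j)%N))
    = expR (- s) * (expR (- t) * limn (exp_series s w)).
  congr (_ * _); apply: cvg_lim => //.
  rewrite (_ : exp_series s _ = (fun n => expR (- t) * exp_series s w n)).
    apply: cvgM; first exact: cvg_cst.
    exact: (@is_cvg_exp_series s w _ wK).
  apply/funext => n; rewrite /exp_series !seriesEnat /= mulr_sumr.
  by apply: eq_bigr => i _; rewrite mulrCA.
rewrite /poisson_avg opprD expRD -mulrA; congr (_ * (_ * _)).
have cp := cauchy_product s t (fun i j => zK (i + j)%N).
apply/esym/eqP; rewrite -subr_eq0; apply/eqP.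
rewrite -limB; [|exact: (@is_cvg_exp_series _ _ _ wK)|exact: (@is_cvg_exp_series _ _ _ zK)].
apply: cvg_lim => //; apply: cvg_trans cp; apply: near_eq_cvg.
apply: nearW => n /=; congr (_ - _).
rewrite /exp_series seriesEnat /=; apply: eq_bigr => k _.
rewrite exp_coeffD mulr_suml !big_nat; apply: eq_bigr => i /=.
by rewrite ltnS => ik; rewrite subnKC.
Qed.

(** In the same reading, [exp (- l (1 - Q)) = exp (- l) exp (l Q)]. *)
Lemma poisson_avg_alternating l z K : (forall k, `|z k| <= K) ->
  series (fun k => ec (- l) k *
    \sum_(0 <= j < k.+1) 'C(k, j)%:R * (-1) ^+ j * z j) @ \oo
    --> poisson_avg l z.
Proof.
move=> zK; have cp := @cauchy_product (- l) l (fun _ j => z j) K (fun _ => zK).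
set W := limn (exp_series l z) in cp.
have h1 : exp_series (- l) (fun=> W) n @[n --> \oo] --> poisson_avg l z.
  rewrite /poisson_avg -/W.
  have -> : exp_series (- l) (fun=> W) = (fun n => series (ec (- l)) n * W).
    by apply/funext => n; rewrite /exp_series !seriesEnat /= mulr_suml.
  apply: cvgM; last exact: (cvg_cst W).
  exact: is_cvg_series_exp_coeff.
have := cvgB h1 cp; rewrite subr0 => /(_ _); set u := (X in X @ _ --> _).
suff -> : series (fun k => ec (- l) k *
    \sum_(0 <= j < k.+1) 'C(k, j)%:R * (-1) ^+ j * z j) = u by apply.
apply/funext => n; rewrite /u /= opprB addrC subrK seriesEnat /=.
apply: eq_bigr => k _; rewrite [RHS]big_nat_rev/= mulr_sumr add0n !big_nat.
apply: eq_bigr => j; rewrite !ltnS => /= jk; rewrite subSS subKn// !mulrA.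
congr (_ * _); rewrite /exp_coeff /=.
have nz n' : n'`!%:R != 0 :> R by rewrite pnatr_eq0 -lt0n fact_gt0.
have : 'C(k, j)%:R * (j`!%:R * (k - j)`!%:R) = k`!%:R :> R.
  by rewrite -!natrM bin_fact.
move=> <-; rewrite -[in (- l) ^+ k](subnK jk) exprD -[- l]mulN1r.
have sgn : (-1) ^+ j * (-1) ^+ j = 1 :> R by rewrite -expr2 sqrr_sign.
rewrite [(-1 * l) ^+ j]exprMn.
have c0 : 'C(k, j)%:R != 0 :> R by rewrite pnatr_eq0 -lt0n bin_gt0.
transitivity ((-1 * l) ^+ (k - j) * l ^+ j * ((-1) ^+ j * (-1) ^+ j)
   / (j`!%:R * (k - j)`!%:R)); last by rewrite sgn; field; rewrite !nz.
by field; rewrite !nz c0.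
Qed.

Lemma poisson_avg_cst l c : poisson_avg l (fun=> c) = c.
Proof.
rewrite /poisson_avg; have -> : exp_series l (fun=> c) = (fun n => series (ec l) n * c).
  by apply/funext => n; rewrite /exp_series !seriesEnat /= mulr_suml.
rewrite (@cvg_lim _ _ _ _ _ _ (expR l * c))// ?mulrA ?[expR (- l) * _]mulrC ?expRxMexpNx_1 ?mul1r//.
by apply: cvgM; [exact: is_cvg_series_exp_coeff|exact: cvg_cst].
Qed.

Lemma exp_series_geometric l x : exp_series l (fun k => x ^+ k) = series (ec (l * x)).
Proof.
congr series; apply/funext => k.
by rewrite /exp_coeff /= exprMn mulrAC.
Qed.

Lemma poisson_avg_geometric l x :
  poisson_avg l (fun k => x ^+ k) = expR (l * x - l).
Proof. by rewrite /poisson_avg exp_series_geometric addrC expRD. Qed.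

Lemma poisson_avg_linear l (a : R) y z :
  cvgn (exp_series l y) -> cvgn (exp_series l z) ->
  cvgn (exp_series l (fun k => a * y k + z k)) /\
  poisson_avg l (fun k => a * y k + z k)
    = a * poisson_avg l y + poisson_avg l z.
Proof.
move=> cy cz; have E : exp_series l (fun k => a * y k + z k)
    = (fun n => a * exp_series l y n + exp_series l z n).
  apply/funext => n; rewrite /exp_series !seriesEnat /= mulr_sumr -big_split/=.
  by apply: eq_bigr => k _; ring.
have L : (fun n => a * exp_series l y n + exp_series l z n) @ \oo
    --> a * limn (exp_series l y) + limn (exp_series l z).
  by apply: cvgD => //; apply: cvgM => //; exact: cvg_cst.
rewrite E; split; first by apply: cvgP L.
by rewrite /poisson_avg E (cvg_lim _ L)//; ring.
Qed.

Lemma poisson_avg_sum (I : Type) (r : seq I) l (w : I -> R) (y : I -> R ^nat) :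
  (forall i, cvgn (exp_series l (y i))) ->
  cvgn (exp_series l (fun k => \sum_(i <- r) w i * y i k)) /\
  poisson_avg l (fun k => \sum_(i <- r) w i * y i k)
    = \sum_(i <- r) w i * poisson_avg l (y i).
Proof.
move=> cy; elim: r => [|i r [IHc IHe]].
  under eq_fun do rewrite big_nil.
  rewrite big_nil poisson_avg_cst; split=> //.
  by apply: (@is_cvg_exp_series _ _ 0) => k; rewrite normr0.
under eq_fun do rewrite big_cons.
by rewrite big_cons -IHe; exact: poisson_avg_linear.
Qed.

Lemma le_poisson_avg l y z : 0 <= l ->
  cvgn (exp_series l y) -> cvgn (exp_series l z) ->
  (forall k, y k <= z k) -> poisson_avg l y <= poisson_avg l z.
Proof.
move=> l0 cy cz yz; apply: ler_wpM2l; first exact: expR_ge0.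
apply: ler_lim => //; apply: nearW => n; rewrite /exp_series !seriesEnat /=.
by apply: ler_sum => k _; rewrite ler_wpM2l// exp_coeff_nneg.
Qed.

Lemma normr_poisson_avg_le l z K : 0 <= l -> (forall k, `|z k| <= K) ->
  `|poisson_avg l z| <= K.
Proof.
move=> l0 zK; have K0 : 0 <= K by exact: le_trans (zK 0%N).
have cK x : `|x| <= K -> cvgn (exp_series l (fun=> x)).
  by move=> xK; apply: (@is_cvg_exp_series _ _ K) => k.
rewrite ler_norml -{1}(poisson_avg_cst l (- K)) -{2}(poisson_avg_cst l K).
apply/andP; split; apply: le_poisson_avg => //.
- by apply: cK; rewrite normrN ger0_norm.
- exact: is_cvg_exp_series zK.
- by move=> k; have := zK k; rewrite ler_norml => /andP[].
- exact: is_cvg_exp_series zK.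
- by apply: cK; rewrite ger0_norm.
- by move=> k; have := zK k; rewrite ler_norml => /andP[].
Qed.

End Poisson.

(** * The lazy random walk *)

(** The discrete form of the weighted energy estimate for the heat equation.
    Here [beta x y / m x] is the probability of a jump from [x] to [y], at most
    [1/2] in total, and [xi] is a weight of logarithmic slope at most [eta]: one
    step of the walk increases the weighted energy by a factor [1 + O (eta ^ 2)],
    and not [1 + O (eta)]: the term of first order in [eta] is absorbed by half of
    the dissipated energy, the other half paying for the discrete time step. *)
Lemma weighted_energy_step (R : realType) (X : eqType) (W : seq X)
    (m xi h : X -> R) (beta : X -> X -> R) (eta : R) :
  (forall x, 0 < m x) -> (forall x, 0 < xi x) ->
  (forall x y, 0 <= beta x y) -> (forall x y, beta x y = beta y x) ->
  (forall x, \sum_(y <- W) beta x y <= m x / 2) ->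
  (forall x y, 0 < beta x y -> (xi x - xi y) ^+ 2 <= eta ^+ 2 * (xi x * xi y)) ->
  \sum_(x <- W) m x * xi x
      * (h x - (m x)^-1 * \sum_(y <- W) beta x y * (h x - h y)) ^+ 2
    <= (1 + eta ^+ 2 / 4) * \sum_(x <- W) m x * xi x * h x ^+ 2.
Proof.
move=> m0 xi0 b0 bC bm bxi.
set E := \sum_(x <- W) m x * xi x * h x ^+ 2.
pose G x := \sum_(y <- W) beta x y * (h x - h y).
pose G2 x := \sum_(y <- W) beta x y * (h x - h y) ^+ 2.
(* By laziness, the square of the increment costs at most half the energy. *)
have GG2 x : G x ^+ 2 <= m x / 2 * G2 x.
  have := cauchy_schwarz_sum W (fun y => h x - h y) (fun=> 1) (b0 x).
  under eq_bigr do rewrite mulr1.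
  under [X in _ * X]eq_bigr do rewrite expr1n mulr1.
  move=> /le_trans; apply; rewrite mulrC ler_wpM2r ?bm//.
  by apply: sumr_ge0 => y _; rewrite mulr_ge0 ?sqr_ge0.
have step x : m x * xi x * (h x - (m x)^-1 * G x) ^+ 2
    <= m x * xi x * h x ^+ 2 - (2 * xi x * h x * G x - xi x / 2 * G2 x).
  have -> : m x * xi x * (h x - (m x)^-1 * G x) ^+ 2
      = m x * xi x * h x ^+ 2 - 2 * xi x * h x * G x
        + xi x * ((m x)^-1 * G x ^+ 2).
    by field; rewrite gt_eqF.
  rewrite opprB addrA [leRHS]addrAC lerD2l -mulrA ler_pM2l//.
  by rewrite ler_pdivrMl// mulrA.
have symm : \sum_(x <- W) 2 * xi x * h x * G x
    = \sum_(x <- W) \sum_(y <- W)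
        beta x y * ((h x - h y) * (xi x * h x - xi y * h y)).
  have E1 : \sum_(x <- W) xi x * h x * G x
      = \sum_(x <- W) \sum_(y <- W) beta x y * ((h x - h y) * (xi x * h x)).
    by apply: eq_bigr => x _; rewrite mulr_sumr; apply: eq_bigr => y _; ring.
  have E2 : \sum_(x <- W) xi x * h x * G x
      = \sum_(x <- W) \sum_(y <- W) beta x y * ((h x - h y) * (- (xi y * h y))).
    rewrite E1 exchange_big/=; apply: eq_bigr => x _; apply: eq_bigr => y _.
    by rewrite bC; ring.
  have -> : \sum_(x <- W) 2 * xi x * h x * G x
      = \sum_(x <- W) xi x * h x * G x + \sum_(x <- W) xi x * h x * G x.
    by rewrite -big_split/=; apply: eq_bigr => x _; ring.
  rewrite {1}E1 E2 -big_split/=; apply: eq_bigr => x _; rewrite -big_split/=.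
  by apply: eq_bigr => y _; ring.
have edge x y : beta x y * (xi x / 2 * (h x - h y) ^+ 2
      - (h x - h y) * (xi x * h x - xi y * h y))
    <= beta x y * (eta ^+ 2 / 2 * (xi y * h y ^+ 2)).
  have := b0 x y; rewrite le_eqVlt => /predU1P[<-|bp]; first by rewrite !mul0r.
  rewrite ler_pM2l//; have xe := bxi _ _ bp.
  suff : 2 * xi x * (xi x / 2 * (h x - h y) ^+ 2
      - (h x - h y) * (xi x * h x - xi y * h y))
    <= 2 * xi x * (eta ^+ 2 / 2 * (xi y * h y ^+ 2)).
    by rewrite ler_pM2l// mulr_gt0.
  apply: (@le_trans _ _ ((xi x - xi y) ^+ 2 * h y ^+ 2)).
    rewrite -subr_ge0; set u := (X in 0 <= X).
    have -> : u = (xi x * (h x - h y) + (xi x - xi y) * h y) ^+ 2 by rewrite /u; field.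
    exact: sqr_ge0.
  apply: (@le_trans _ _ (eta ^+ 2 * (xi x * xi y) * h y ^+ 2)).
    by rewrite ler_wpM2r ?sqr_ge0.
  by rewrite le_eqVlt; apply/orP; left; apply/eqP; field.
have tot : \sum_(x <- W) (xi x / 2 * G2 x - 2 * xi x * h x * G x)
    <= eta ^+ 2 / 4 * E.
  rewrite sumrB symm.
  have -> : \sum_(x <- W) xi x / 2 * G2 x
      = \sum_(x <- W) \sum_(y <- W) beta x y * (xi x / 2 * (h x - h y) ^+ 2).
    by apply: eq_bigr => x _; rewrite mulr_sumr; apply: eq_bigr => y _; ring.
  rewrite -sumrB; under eq_bigr do rewrite -sumrB.
  apply: (@le_trans _ _ (\sum_(x <- W) \sum_(y <- W)
      beta x y * (eta ^+ 2 / 2 * (xi y * h y ^+ 2)))).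
    by apply: ler_sum => x _; apply: ler_sum => y _; rewrite -mulrBr.
  rewrite exchange_big/= /E mulr_sumr; apply: ler_sum => y _.
  rewrite -mulr_suml.
  apply: (@le_trans _ _ (m y / 2 * (eta ^+ 2 / 2 * (xi y * h y ^+ 2)))).
    rewrite ler_wpM2r//.
      by rewrite ?(sqr_ge0, mulr_ge0)// ltW.
    by under eq_bigr do rewrite bC.
  by rewrite le_eqVlt; apply/orP; left; apply/eqP; field.
apply: (@le_trans _ _ (\sum_(x <- W) (m x * xi x * h x ^+ 2
    - (2 * xi x * h x * G x - xi x / 2 * G2 x)))).
  by apply: ler_sum => x _; exact: step.
rewrite mulrDl mul1r sumrB lerD2l -sumrN.
by under eq_bigr do rewrite opprB.
Qed.

Lemma ler_sum_fset (R : realType) (X : choiceType) (A B : {fset X}) (F : X -> R) :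
  (A `<=` B)%fset -> (forall x, 0 <= F x) ->
  \sum_(x <- A) F x <= \sum_(x <- B) F x.
Proof.
move=> AB F0; rewrite [leRHS](big_fsetID _ (mem A))/=.
have -> : \sum_(x <- [fset x in B | x \in A]%fset) F x = \sum_(x <- A) F x.
  by apply: eq_fbigl => x; rewrite !inE /= -(@in_fsetI _ B A) (fsetIidPr _).
by rewrite lerDl sumr_ge0.
Qed.

Section LazyWalk.
Context {R : realType} {X : countType} (m : X -> {posnum R}) (b : graph R X).
Context (C : R) (lf : locally_finite b) (C0 : 0 < C).
Context (degC : forall x, deg b m x <= C / 2).
Implicit Types (phi psi g h : X -> R) (V W : {fset X}).

Let m_gt0 x : 0 < (m x)%:num. Proof. by []. Qed.

(** The Markov operator [Q] of a walk whose jumps from [x] have total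
    probability [deg x / C], chosen so that the Laplacian is [C (1 - Q)]. *)
Definition walk phi (x : X) : R := phi x - C^-1 * laplacian b m phi x.

Definition neighbours (x : X) : {fset X} := fset_set [set y | adjacent b x y].

Definition fneighbourhood V : {fset X} :=
  (V `|` fset_set (\bigcup_(x in [set` V]) [set y | adjacent b x y])%classic)%fset.

Definition supported_in V h := forall x, x \notin V -> h x = 0.

Lemma weight_notin x y : y \notin neighbours x -> b x y = 0.
Proof.
rewrite /neighbours in_fset_set ?inE; last exact: lf.
move=> h; apply/eqP; rewrite eq_le weight_ge0 andbT leNgt.
by apply/negP => h'; move/negP: h; apply; exact/mem_set.
Qed.

Lemma weight_out V x y : x \in V -> y \notin fneighbourhood V -> b x y = 0.
Proof.
move=> xV yV; apply/eqP; rewrite eq_le weight_ge0 andbT leNgt; apply/negP => h.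
move/negP: yV; apply; rewrite inE; apply/orP; right.
rewrite in_fset_set; first by apply/mem_set; exists x.
by apply: bigcup_finite => [|z _]; [exact: finite_fset|exact: lf].
Qed.

Lemma fneighbourhoodW V x : x \in V -> x \in fneighbourhood V.
Proof. by move=> xV; rewrite inE xV. Qed.

Lemma supportedW V h : supported_in V h -> supported_in (fneighbourhood V) h.
Proof. by move=> hV x xV; apply: hV; apply: contra xV; exact: fneighbourhoodW. Qed.

Lemma fsum_neighbours x g :
  \sum_(y \in [set: X]) b x y * g y = \sum_(y <- neighbours x) b x y * g y.
Proof. by apply: fsbigTE => y /weight_notin ->; rewrite mul0r. Qed.

Lemma deg_neighbours x :
  deg b m x = ((m x)%:num)^-1 * \sum_(y <- neighbours x) b x y.
Proof. by rewrite /deg; congr (_ * _); apply: fsbigTE => y /weight_notin. Qed.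

Lemma walkE phi x : walk phi x = (1 - deg b m x / C) * phi x
  + (C * (m x)%:num)^-1 * \sum_(y \in [set: X]) b x y * phi y.
Proof.
rewrite /walk /laplacian !fsum_neighbours deg_neighbours.
have -> : \sum_(y <- neighbours x) b x y * (phi x - phi y)
    = (\sum_(y <- neighbours x) b x y) * phi x
      - \sum_(y <- neighbours x) b x y * phi y.
  by rewrite mulr_suml -sumrB; apply: eq_bigr => y _; rewrite mulrBr.
by field; rewrite !gt_eqF.
Qed.

Lemma laplacian_walk phi x : laplacian b m phi x = C * (phi x - walk phi x).
Proof. by rewrite /walk opprB addrC subrK mulrA mulfV ?mul1r// gt_eqF. Qed.

Lemma walk_cst c : walk (fun=> c) = fun=> c.
Proof.
apply/funext => x; rewrite /walk /laplacian fsbig1 ?mulr0 ?subr0// => y _.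
by rewrite subrr mulr0.
Qed.

Lemma walk_linear a phi psi x :
  walk (fun y => a * phi y + psi y) x = a * walk phi x + walk psi x.
Proof.
rewrite !walkE !fsum_neighbours.
have -> : \sum_(y <- neighbours x) b x y * (a * phi y + psi y)
    = a * (\sum_(y <- neighbours x) b x y * phi y)
      + \sum_(y <- neighbours x) b x y * psi y.
  by rewrite mulr_sumr -big_split/=; apply: eq_bigr => y _; ring.
ring.
Qed.

Lemma half_le_stay x : 2^-1 <= 1 - deg b m x / C.
Proof.
have : deg b m x / C <= 2^-1 by rewrite ler_pdivrMr// mulrC.
lra.
Qed.

(** Laziness: the walk stays where it is with probability at least [1/2]. *)
Lemma walk_lazy phi x : (forall y, 0 <= phi y) -> phi x / 2 <= walk phi x.
Proof.
move=> phi0; rewrite walkE fsum_neighbours mulrC -[leLHS]addr0 lerD//.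
  by rewrite ler_wpM2r// half_le_stay.
rewrite mulr_ge0// ?invr_ge0 ?mulr_ge0// ?(ltW C0)//.
by apply: sumr_ge0 => y _; rewrite mulr_ge0// weight_ge0.
Qed.

Lemma walk_ge0 phi : (forall y, 0 <= phi y) -> forall x, 0 <= walk phi x.
Proof. by move=> phi0 x; apply: le_trans (walk_lazy x phi0); rewrite divr_ge0. Qed.

Lemma le_walk phi psi : (forall y, phi y <= psi y) ->
  forall x, walk phi x <= walk psi x.
Proof.
move=> h x; rewrite -subr_ge0.
have -> : walk psi x - walk phi x = walk (fun y => (-1) * phi y + psi y) x.
  by rewrite walk_linear mulN1r addrC.
by apply: walk_ge0 => y; rewrite mulN1r addrC subr_ge0.
Qed.

Lemma normr_walk_le phi K : (forall y, `|phi y| <= K) ->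
  forall x, `|walk phi x| <= K.
Proof.
move=> h x; rewrite ler_norml.
have : walk (fun=> - K) x <= walk phi x.
  by apply: le_walk => y; have := h y; rewrite ler_norml => /andP[].
have : walk phi x <= walk (fun=> K) x.
  by apply: le_walk => y; have := h y; rewrite ler_norml => /andP[].
by rewrite !walk_cst => -> ->.
Qed.

Lemma walk_jensen (f : R -> R) :
  convex_function (`[0, +oo[%classic : set R^o) f ->
  (forall s, 0 <= s -> 0 <= f s) -> f 0 = 0 ->
  forall phi, (forall y, 0 <= phi y) -> forall x, f (walk phi x) <= walk (f \o phi) x.
Proof.
move=> cf f0 f00 phi phi0 x.
have [c hc] := supporting_line cf f0 f00 (walk_ge0 phi0 x).
have -> : f (walk phi x) = walk (fun y => c * phi y + (f (walk phi x) - c * walk phi x)) x.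
  by rewrite walk_linear (walk_cst (f (walk phi x) - _)); ring.
by apply: le_walk => y /=; have := hc (phi y) (phi0 y); lra.
Qed.

Lemma iter_walk_cst c k : iter k walk (fun=> c) = fun=> c.
Proof. by elim: k => //= k ->; exact: walk_cst. Qed.

Lemma iter_walk_linear a phi psi k x :
  iter k walk (fun y => a * phi y + psi y) x
    = a * iter k walk phi x + iter k walk psi x.
Proof.
elim: k x => //= k IH x; rewrite -walk_linear.
by congr walk; apply/funext => y; exact: IH.
Qed.

Lemma le_iter_walk k phi psi : (forall y, phi y <= psi y) ->
  forall x, iter k walk phi x <= iter k walk psi x.
Proof. by move=> h; elim: k => //= k IH; exact: le_walk. Qed.

Lemma normr_iter_walk_le k phi K : (forall y, `|phi y| <= K) ->
  forall x, `|iter k walk phi x| <= K.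
Proof. by move=> h; elim: k => //= k IH; exact: normr_walk_le. Qed.

Lemma supported_walk V h : supported_in V h ->
  supported_in (fneighbourhood V) (walk h).
Proof.
move=> hV x xV; rewrite walkE (supportedW hV xV) mulr0 add0r.
rewrite fsbig1 ?mulr0// => y _.
have [yV|/hV->] := boolP (y \in V); last by rewrite mulr0.
by rewrite weightC (weight_out yV xV) mul0r.
Qed.

Definition pairing h g := \sum_(x \in [set: X]) (m x)%:num * (h x * g x).

Lemma pairingE V h g : supported_in V h ->
  pairing h g = \sum_(x <- V) (m x)%:num * (h x * g x).
Proof. by move=> hV; apply: fsbigTE => x /hV ->; rewrite mul0r mulr0. Qed.

(** Reversibility, which comes from the symmetry of [b]. *)
Lemma pairing_walk V h g : supported_in V h ->
  pairing (walk h) g = pairing h (walk g).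
Proof.
move=> hV; rewrite (pairingE _ (supported_walk hV)) (pairingE _ (supportedW hV)).
set W := fneighbourhood V.
have E1 x : (m x)%:num * (walk h x * g x)
    = (m x)%:num * (1 - deg b m x / C) * h x * g x
      + C^-1 * \sum_(y <- W) b x y * h y * g x.
  rewrite walkE (fsbigTE W) => [|y /(supportedW hV)->]; last by rewrite mulr0.
  by rewrite -mulr_suml; field; rewrite !gt_eqF.
have E2 x : (m x)%:num * (h x * walk g x)
    = (m x)%:num * (1 - deg b m x / C) * h x * g x
      + C^-1 * \sum_(y <- W) b x y * h x * g y.
  have -> : \sum_(y <- W) b x y * h x * g y
      = h x * \sum_(y \in [set: X]) b x y * g y.
    have [xV|/hV->] := boolP (x \in V); last first.
      by rewrite mul0r big1// => y _; rewrite mulr0 mul0r.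
    rewrite (fsbigTE W) => [|y yW]; last by rewrite (weight_out xV yW) mul0r.
    by rewrite mulr_sumr; apply: eq_bigr => y _; ring.
  by rewrite walkE; field; rewrite !gt_eqF.
under eq_bigr do rewrite E1; under [RHS]eq_bigr do rewrite E2.
rewrite !big_split/=; congr (_ + _); rewrite -!mulr_sumr exchange_big/=.
congr (_ * _); apply: eq_bigr => x _; apply: eq_bigr => y _.
by rewrite weightC.
Qed.

(** The density with respect to [m] of the position after [k] steps from [o];
    as the graph is locally finite, it has finite support. *)
Definition walk_kernel (o : X) k : X -> R :=
  iter k walk (fun x => (x == o)%:R / (m o)%:num).

Lemma walk_kernel_ge0 o k x : 0 <= walk_kernel o k x.
Proof.
rewrite /walk_kernel; elim: k x => [|k IH] x /=; first by rewrite divr_ge0.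
exact: walk_ge0.
Qed.

Lemma walk_kernel_supported o k : exists V, supported_in V (walk_kernel o k).
Proof.
elim: k => [|k [V hV]].
  exists [fset o]%fset => x; rewrite inE => /negbTE xo.
  by rewrite /walk_kernel /= xo mul0r.
by exists (fneighbourhood V); exact: supported_walk.
Qed.

Lemma pairing_walk_kernel o k phi :
  pairing (walk_kernel o k) phi = iter k walk phi o.
Proof.
elim: k phi => [|k IH] phi; last first.
  have [V hV] := walk_kernel_supported o k.
  by rewrite iterSr -IH -(pairing_walk _ hV).
rewrite (@pairingE [fset o]%fset) => [|x]; last first.
  by rewrite inE => /negbTE xo; rewrite /walk_kernel /= xo mul0r.
by rewrite big_seq_fset1 /walk_kernel /= eqxx mulr1n; field; rewrite gt_eqF.
Qed.

Lemma walk_kernel_mass o k : pairing (walk_kernel o k) (fun=> 1) = 1.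
Proof. by rewrite pairing_walk_kernel iter_walk_cst. Qed.

(** The return probability is an energy, to which Cauchy-Schwarz applies. *)
Lemma walk_kernel_diag o j :
  walk_kernel o (j + j) o = pairing (walk_kernel o j) (walk_kernel o j).
Proof. by rewrite pairing_walk_kernel /walk_kernel iterD. Qed.

Lemma iter_walk_ge_kernel o k phi : (forall y, 0 <= phi y) ->
  phi o * (m o)%:num * walk_kernel o k o <= iter k walk phi o.
Proof.
move=> phi0; rewrite -pairing_walk_kernel.
have [V hV] := walk_kernel_supported o k; rewrite (pairingE _ hV).
have pos x : 0 <= (m x)%:num * (walk_kernel o k x * phi x).
  by rewrite !mulr_ge0// walk_kernel_ge0.
have [oV|/hV->] := boolP (o \in V); last by rewrite mulr0 sumr_ge0.
rewrite (big_fsetD1 o)//=.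
rewrite -[leLHS]addr0 lerD ?sumr_ge0// le_eqVlt.
by apply/orP; left; apply/eqP; ring.
Qed.

Lemma walk_kernel_lazy o k : walk_kernel o k o / 2 <= walk_kernel o k.+1 o.
Proof. by apply: walk_lazy => y; exact: walk_kernel_ge0. Qed.

Section OnDiagonal.
Context (d : X -> nat) (d_adj : forall x y, adjacent b x y -> (d y <= (d x).+1)%N).
Context (o : X) (eta : R) (eta0 : 0 <= eta).

Lemma walk_kernel_range k x : walk_kernel o k x != 0 -> (d x <= k + d o)%N.
Proof.
elim: k x => [|k IH] x.
  rewrite /walk_kernel /=; have [->//|] := eqVneq x o.
  by rewrite mul0r eqxx.
apply: contraNT; rewrite -ltnNge addSn => dx; rewrite /walk_kernel iterS.
rewrite -/(walk_kernel o k) walkE.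
have small y : (k + d o < d y)%N -> walk_kernel o k y = 0.
  by move=> dy; apply/eqP; apply: contraTT dy => /IH; rewrite -leqNgt.
rewrite small 1?ltnW// mulr0 add0r fsbig1 ?mulr0// => y _.
have := weight_ge0 b x y; rewrite le_eqVlt => /predU1P[<-|bxy]; first by rewrite mul0r.
rewrite small ?mulr0// -ltnS; apply: (leq_trans dx).
by apply: d_adj; rewrite /adjacent weightC.
Qed.

Let xi x := (1 + eta) ^+ d x.

Let xi_gt0 x : 0 < xi x.
Proof. by rewrite exprn_gt0// ltr_wpDr. Qed.

Let xi_adj x y : adjacent b x y ->
  (xi x - xi y) ^+ 2 <= eta ^+ 2 * (xi x * xi y).
Proof.
have main u v : (d u <= d v)%N -> (d v <= (d u).+1)%N ->
    (xi u - xi v) ^+ 2 <= eta ^+ 2 * (xi u * xi v).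
  move=> uv vu; have [E|ne] := eqVneq (d u) (d v).
    by rewrite /xi E subrr expr0n /= ?(sqr_ge0, mulr_ge0) ?exprn_ge0 ?addr_ge0.
  have E : d v = (d u).+1 by apply/eqP; rewrite eqn_leq vu ltn_neqAle ne uv.
  rewrite /xi E [_ ^+ (d u).+1]exprS -/(xi u).
  have -> : (xi u - (1 + eta) * xi u) ^+ 2 = eta ^+ 2 * (xi u * xi u) by ring.
  rewrite ler_wpM2l ?sqr_ge0// ler_wpM2l ?(ltW (xi_gt0 _))//.
  by rewrite ler_peMl ?(ltW (xi_gt0 _))// lerDl.
move=> xy; have yx : adjacent b y x by rewrite /adjacent weightC.
have [dxy|/ltnW dyx] := leqP (d x) (d y).
  by apply: main => //; exact: d_adj.
by rewrite -sqrrN opprB [xi x * _]mulrC; apply: main => //; exact: d_adj.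
Qed.

Lemma walk_weighted_energy V h : supported_in V h ->
  pairing (walk h) (fun x => xi x * walk h x)
    <= (1 + eta ^+ 2 / 4) * pairing h (fun x => xi x * h x).
Proof.
move=> hV; rewrite (pairingE _ (supported_walk hV)) (pairingE _ (supportedW hV)).
set W := fneighbourhood V.
pose beta x y := C^-1 * b x y.
have wE x : walk h x
    = h x - ((m x)%:num)^-1 * \sum_(y <- W) beta x y * (h x - h y).
  rewrite /walk /laplacian (fsbigTE W).
    rewrite mulrCA mulr_sumr; congr (_ - _ * _).
    by apply: eq_bigr => y _; rewrite mulrA.
  move=> y yW; have [xV|/hV->] := boolP (x \in V).
    by rewrite (weight_out xV yW) mul0r.
  by rewrite (supportedW hV yW) subrr mulr0.
have step := @weighted_energy_step R X W (fun x => (m x)%:num) xi h beta eta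
  m_gt0 xi_gt0.
have beta0 x y : 0 <= beta x y by rewrite mulr_ge0 ?weight_ge0// invr_ge0 ltW.
have betaC x y : beta x y = beta y x by rewrite /beta weightC.
apply: (le_trans _ (le_trans (step beta0 betaC _ _) _)).
- by rewrite le_eqVlt; apply/orP; left; apply/eqP/eq_bigr => x _; rewrite -wE; ring.
- move=> x; suff : ((m x)%:num)^-1 * \sum_(y <- W) b x y <= C / 2.
    by rewrite -mulr_sumr !ler_pdivrMl//; lra.
  apply: le_trans (degC x).
  rewrite deg_neighbours; apply: ler_wpM2l; first by rewrite invr_ge0.
  have -> : \sum_(y <- neighbours x) b x y = \sum_(y <- (W `|` neighbours x)%fset) b x y.
    apply: big_fset_incl; first exact: fsubsetUr.
    by move=> y _ /weight_notin.
  by apply: ler_sum_fset; [exact: fsubsetUl|move=> y; exact: weight_ge0].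
- move=> x y bxy; apply: xi_adj; move: bxy; rewrite /beta pmulr_rgt0 ?invr_gt0//.
- rewrite le_eqVlt; apply/orP; left; apply/eqP; congr (_ * _).
  by apply: eq_bigr => x _; ring.
Qed.

Lemma walk_kernel_weighted_energy k :
  pairing (walk_kernel o k) (fun x => xi x * walk_kernel o k x)
    <= (1 + eta ^+ 2 / 4) ^+ k * (xi o / (m o)%:num).
Proof.
elim: k => [|k IH].
  rewrite pairing_walk_kernel /= expr0 mul1r /walk_kernel /=.
  by rewrite eqxx mul1r.
have [V hV] := walk_kernel_supported o k.
apply: (le_trans (walk_weighted_energy hV)); rewrite [_ ^+ k.+1]exprS -mulrA.
by apply: ler_wpM2l => //; rewrite addr_ge0// divr_ge0// sqr_ge0.
Qed.

(** Half of the mass of the walk after [j] steps lies at distance at most [r]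
    by the weighted estimate, and Cauchy-Schwarz on that ball bounds the return
    probability after [2 j] steps from below. *)
Lemma walk_kernel_diag_ge (j r : nat) (A B : R) :
  (forall V, (forall x, x \in V -> (d x <= r)%N) -> \sum_(x <- V) (m x)%:num <= A) ->
  (forall V, (forall x, x \in V -> (d x <= j + d o)%N) ->
    \sum_(x <- V) (m x)%:num <= B) ->
  4 * ((1 + eta ^+ 2 / 4) ^+ j * (xi o / (m o)%:num)) * B <= (1 + eta) ^+ r ->
  1 <= 4 * A * walk_kernel o (j + j) o.
Proof.
move=> hA hB hr; set h := walk_kernel o j.
have [V0 hV0] := walk_kernel_supported o j.
pose V := [fset x in V0 | (d x <= j + d o)%N]%fset.
have hV : supported_in V h.
  move=> x; rewrite !inE negb_and => /orP[/hV0//|].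
  by apply: contraNeq => /walk_kernel_range.
have mass := walk_kernel_mass o j; rewrite (pairingE _ hV) in mass.
have h0 x : 0 <= h x by exact: walk_kernel_ge0.
pose q : R := (1 + eta) ^+ r.
have q0 : 0 < q by rewrite exprn_gt0// ltr_wpDr.
pose Vi := [fset x in V | (d x <= r)%N]%fset.
pose Vo := [fset x in V | ~~ (d x <= r)%N]%fset.
have split (F : X -> R) : \sum_(x <- V) F x = \sum_(x <- Vi) F x + \sum_(x <- Vo) F x.
  by rewrite (big_fsetID _ (fun x => (d x <= r)%N))/=.
have xij := ltW (xi_gt0 _).
have out : (\sum_(x <- Vo) (m x)%:num * h x) ^+ 2 <= 4^-1.
  have cs := cauchy_schwarz_sum Vo h (fun x => (xi x)^-1)
    (w := fun x => (m x)%:num * xi x) (fun x => mulr_ge0 (ltW (m_gt0 x)) (xij x)).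
  have E1 : \sum_(x <- Vo) (m x)%:num * xi x * (h x * (xi x)^-1)
      = \sum_(x <- Vo) (m x)%:num * h x.
    by apply: eq_bigr => x _; field; rewrite gt_eqF.
  rewrite E1 in cs; apply: (le_trans cs).
  have e1 : \sum_(x <- Vo) (m x)%:num * xi x * h x ^+ 2
      <= (1 + eta ^+ 2 / 4) ^+ j * (xi o / (m o)%:num).
    apply: le_trans (walk_kernel_weighted_energy j); rewrite (pairingE _ hV) split.
    have -> : \sum_(x <- Vo) (m x)%:num * xi x * h x ^+ 2
        = \sum_(x <- Vo) (m x)%:num * (h x * (xi x * h x)).
      by apply: eq_bigr => x _; ring.
    by rewrite lerDr sumr_ge0// => x _; rewrite !mulr_ge0.
  have e2 : \sum_(x <- Vo) (m x)%:num * xi x * (xi x)^-1 ^+ 2 <= B / q.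
    apply: (@le_trans _ _ (\sum_(x <- Vo) (m x)%:num / q)).
      rewrite !big_seq; apply: ler_sum => x; rewrite !inE => /andP[_ dx].
      have -> : (m x)%:num * xi x * (xi x)^-1 ^+ 2 = (m x)%:num / xi x.
        by field; rewrite gt_eqF.
      rewrite ler_wpM2l// lef_pV2 ?posrE//; apply: ler_weXn2l.
        by rewrite lerDl.
      by apply: ltnW; rewrite ltnNge.
    rewrite -mulr_suml ler_wpM2r ?invr_ge0 ?(ltW q0)//; apply: hB => x.
    by rewrite !inE => /andP[/andP[]].
  apply: le_trans (ler_pM _ _ e1 e2) _.
  - by rewrite sumr_ge0// => x _; rewrite ?(sqr_ge0, mulr_ge0).
  - by rewrite sumr_ge0// => x _; rewrite ?(sqr_ge0, mulr_ge0).
  - move: hr; rewrite -/q; set e := _ * (xi o / _) => hr.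
    by rewrite mulrA ler_pdivrMr//; lra.
have out2 : \sum_(x <- Vo) (m x)%:num * h x <= 2^-1.
  rewrite -ler_sqr ?nnegrE ?sumr_ge0// => [|x _]; last by rewrite mulr_ge0.
  by apply: le_trans out _; rewrite expr2; lra.
have inn : 2^-1 <= \sum_(x <- Vi) (m x)%:num * h x.
  move: mass; rewrite split; under eq_bigr do rewrite mulr1.
  by under [X in _ + X]eq_bigr do rewrite mulr1; lra.
have cs := cauchy_schwarz_sum Vi h (fun=> 1) (w := fun x => (m x)%:num)
  (fun x => ltW (m_gt0 x)).
have K0 : 0 <= walk_kernel o (j + j) o by exact: walk_kernel_ge0.
have inn2 : (\sum_(x <- Vi) (m x)%:num * h x) ^+ 2 <= walk_kernel o (j + j) o * A.
  under eq_bigr do rewrite -[h _]mulr1; apply: le_trans cs _.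
  apply: ler_pM.
  - by rewrite sumr_ge0// => x _; rewrite ?(sqr_ge0, mulr_ge0).
  - by rewrite sumr_ge0// => x _; rewrite ?(sqr_ge0, mulr_ge0).
  - rewrite walk_kernel_diag (pairingE _ hV) split.
    under eq_bigr do rewrite expr2.
    by rewrite lerDl sumr_ge0// => x _; rewrite !mulr_ge0.
  - under eq_bigr do rewrite expr1n mulr1; apply: hA => x.
    by rewrite !inE => /andP[].
have : 4^-1 <= (\sum_(x <- Vi) (m x)%:num * h x) ^+ 2.
  by apply: (@le_trans _ _ (2^-1 ^+ 2)); [rewrite expr2; lra|rewrite lerXn2r// nnegrE ?(le_trans _ inn)].
lra.
Qed.

End OnDiagonal.
End LazyWalk.

(** * Lower bounds under polynomial volume growth *)

Section CombinatorialDistance.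
Context {R : realType} {X : countType} (m : X -> {posnum R}) (b : graph R X).
Context (conn : connected_graph b).

Lemma comb_distP x y : exists2 s, joined_by b x y s & size s = comb_dist b x y.
Proof.
rewrite /comb_dist; case: pselect => [path_xy|[]]; last first.
  have [s xys] := conn x y.
  by exists (size s); apply/asboolP; exists s.
by case: ex_minnP => n /asboolP[s [xys sn]] _; exists s.
Qed.

Lemma comb_dist_le x y s : joined_by b x y s -> (comb_dist b x y <= size s)%N.
Proof.
move=> xys; rewrite /comb_dist; case: pselect => [path_xy|//].
case: ex_minnP => n _ min; apply: min; apply/asboolP; by exists s.
Qed.

Lemma comb_dist_adj x y z :
  adjacent b y z -> (comb_dist b x z <= (comb_dist b x y).+1)%N.
Proof.
move=> yz; have [s [xs sy] <-] := comb_distP x y.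
rewrite -(size_rcons s z); apply: comb_dist_le.
by split; rewrite ?last_rcons// rcons_path xs sy.
Qed.

Lemma sum_le_vertex_measure x (V : {fset X}) r :
  (forall y, y \in V -> (comb_dist b x y <= r)%N) ->
  ((\sum_(y <- V) (m y)%:num)%:E <= vertex_measure m (comb_ball b x r%:R))%E.
Proof.
move=> Vr; apply: esum_ge; exists [set` V].
  split; first exact: finite_fset.
  by move=> y /= /Vr; rewrite /comb_ball /= ler_nat.
by rewrite -fsbig_seq//= sumEFin.
Qed.

End CombinatorialDistance.

Lemma expR1_le4 (R : realType) : expR 1 <= 4 :> R.
Proof.
have h : 2^-1 <= expR (- 2^-1) :> R.
  by apply: le_trans (expR_ge1Dx _); lra.
have -> : expR 1 = expR (2^-1) ^+ 2 :> R by rewrite -expRM_natl mulfV.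
have h2 : expR (2^-1) <= 2 :> R.
  by move: h; rewrite expRN lef_pV2 ?posrE ?expR_gt0.
have -> : 4 = 2 ^+ 2 :> R by rewrite expr2; lra.
by rewrite lerXn2r ?nnegrE ?expR_ge0.
Qed.

(** The mass of the indices above [M] is at most [exp l / 2 ^ M], by Markov's
    inequality applied to [2 ^ k]. *)
Lemma poisson_avg_ge (R : realType) (l c K : R) (z : R ^nat) M :
  0 <= l -> 0 <= c -> (forall k, 0 <= z k) -> (forall k, `|z k| <= K) ->
  (forall k, (k <= M)%N -> c <= z k) ->
  c * (1 - expR l / 2 ^+ M) <= poisson_avg l z.
Proof.
move=> l0 c0 z0 zK cz.
have c2 : cvgn (exp_series l (fun k => (2 : R) ^+ k)).
  by rewrite exp_series_geometric; exact: is_cvg_series_exp_coeff.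
have cc : cvgn (exp_series l (fun=> c)).
  by apply: (@is_cvg_exp_series _ _ _ c) => _; rewrite ger0_norm.
have [cv pe] := poisson_avg_linear (- (c / 2 ^+ M)) c2 cc.
have -> : c * (1 - expR l / 2 ^+ M)
    = poisson_avg l (fun k => - (c / 2 ^+ M) * 2 ^+ k + c).
  rewrite pe poisson_avg_geometric poisson_avg_cst.
  have -> : l * 2 - l = l by ring.
  by ring.
apply: le_poisson_avg => //; first exact: (@is_cvg_exp_series _ _ _ K).
move=> k; have [kM|Mk] := leqP k M.
  apply: le_trans (cz k kM); rewrite gerDr mulNr oppr_le0.
  by rewrite mulr_ge0 ?divr_ge0 ?exprn_ge0.
apply: le_trans (z0 k).
rewrite mulNr mulrAC addrC subr_le0 ler_pdivlMr ?exprn_gt0//.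
by apply: ler_wpM2l => //; apply: ler_weXn2l; [lra|exact: ltnW].
Qed.

Section ReturnProbability.
Context {R : realType} {X : countType} (m : X -> {posnum R}) (b : graph R X).
Context (C : R) (lf : locally_finite b) (C0 : 0 < C).
Context (degC : forall x, deg b m x <= C / 2) (conn : connected_graph b).
Context (theta : R) (theta0 : 0 < theta) (growth : polynomial_growth b m theta).
Context (o : X).

(** With [N = n ^ (2 l)], weighting by [(1 + eta) ^ d] for [eta = N ^ (- 1/2)]
    costs a bounded factor up to time [2 N]; outside the ball of radius
    [r = s n ^ (l + 1)], slightly more than [N ^ (1/2)], the weight is at least
    [n ^ s], which beats the volume of the ball of radius [4 N].  The return
    probability at even times up to [4 N] follows, and then at odd times by
    laziness. *)
Lemma walk_kernel_ge (l s : nat) : (0 < l)%N -> 2 * l%:R * theta < s%:R ->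
  exists2 c : R, 0 < c & \forall n \near \oo,
    forall k, (k <= 4 * n ^ (2 * l))%N ->
      c / n%:R `^ (l.+1%:R * theta) <= walk_kernel m b C o k o.
Proof.
have aux1 (i e q N : nat) : (i <= 2 * N -> e <= q -> q <= N -> i + e + q <= 4 * N)%N.
  by lia.
have aux2 (i N : nat) : (i <= 4 * N -> i./2 <= 2 * N)%N by lia.
move=> l0 ls; have [x0 [D [r0 [D0 r00 hD]]]] := growth.
pose d := comb_dist b x0.
pose delta := s%:R - 2 * l%:R * theta.
have delta0 : 0 < delta by rewrite subr_gt0.
have s0 : (0 < s)%N.
  by rewrite -(ltr_nat R); apply: le_lt_trans ls; rewrite !mulr_ge0// ltW.
pose K1 := 4 * (expR 1 * (2 ^+ d o / (m o)%:num)) * (D * 4 `^ theta).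
have K10 : 0 < K1.
  by rewrite /K1 !mulr_gt0 ?invr_gt0 ?expR_gt0 ?powR_gt0 ?exprn_gt0.
exists (8 * (D * s%:R `^ theta))^-1.
  by rewrite invr_gt0 !mulr_gt0// powR_gt0// ltr0n.
near=> n => k kN.
have n0 : (0 < n)%N by near: n; exact: nbhs_infty_gt.
have nd : (d o <= n)%N by near: n; exact: nbhs_infty_ge.
have nr0 : r0 < n%:R by near: n; exact: nbhs_infty_gtr.
have nK : K1 `^ delta^-1 <= n%:R by near: n; exact: nbhs_infty_ger.
have nR0 : 0 < n%:R :> R by rewrite ltr0n.
have nR1 : 1 <= n%:R :> R by rewrite ler1n.
have K1n : K1 <= n%:R `^ delta.
  have -> : K1 = (K1 `^ delta^-1) `^ delta.
    by rewrite -powRrM mulVf ?gt_eqF// powRr1// ltW.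
  by apply: ge0_ler_powR; rewrite ?nnegrE ?powR_ge0// ltW.
pose N := (n ^ (2 * l))%N; pose r := (s * n ^ l.+1)%N.
pose eta : R := (n%:R ^+ l)^-1.
have eta0 : 0 <= eta by rewrite invr_ge0 exprn_ge0.
have eta1 : eta <= 1 by rewrite invf_le1 ?exprn_ege1// exprn_gt0.
have etaN : eta ^+ 2 * N%:R = 1.
  rewrite /eta /N natrX mulnC exprM -exprMn mulVf ?expr1n//.
  by rewrite expf_neq0// gt_eqF.
have nN : (n <= N)%N.
  by rewrite /N -{1}(expn1 n) leq_pexp2l// muln_gt0.
have nr : (n <= r)%N.
  by rewrite /r expnS mulnCA leq_pmulr// muln_gt0 s0 expn_gt0 n0.
pose A := D * r%:R `^ theta.
have A0 : 0 < A by rewrite mulr_gt0// powR_gt0 ?ltr0n// (leq_trans n0).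
have AE : A = D * s%:R `^ theta * n%:R `^ (l.+1%:R * theta).
  by rewrite /A /r natrM powRM// natrX -powR_mulrn// -powRrM mulrA.
have hA (V : {fset X}) : (forall x, x \in V -> (d x <= r)%N) -> \sum_(x <- V) (m x)%:num <= A.
  move=> Vr; rewrite -lee_fin; apply: (le_trans (@sum_le_vertex_measure _ _ m b x0 V r Vr)).
  by apply: hD; apply: (lt_le_trans nr0); rewrite ler_nat.
have diag j : (j <= 2 * N)%N -> 1 <= 4 * A * walk_kernel m b C o (j + j) o.
  move=> jN; pose B := D * (j + d o + n)%N%:R `^ theta.
  have hB (V : {fset X}) : (forall x, x \in V -> (d x <= j + d o)%N) ->
      \sum_(x <- V) (m x)%:num <= B.
    move=> Vr; rewrite -lee_fin.
    apply: (le_trans (@sum_le_vertex_measure _ _ m b x0 V (j + d o + n)%N _)).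
      by move=> y /Vr h; apply: (leq_trans h); rewrite leq_addr.
    apply: hD; apply: (lt_le_trans nr0); rewrite ler_nat.
    by rewrite leq_addl.
  apply: (walk_kernel_diag_ge lf C0 degC (d := d) _ eta0 hA hB).
    by move=> x y; exact: comb_dist_adj.
  have e1 : (1 + eta ^+ 2 / 4) ^+ j <= expR 1.
    apply: (@le_trans _ _ (expR (eta ^+ 2 / 4) ^+ j)).
      rewrite lerXn2r ?nnegrE ?expR_ge0 ?expR_ge1Dx//.
      by rewrite addr_ge0// divr_ge0// sqr_ge0.
    rewrite -expRM_natl ler_expR.
    apply: (@le_trans _ _ ((2 * N)%:R * (eta ^+ 2 / 4))).
      by rewrite ler_wpM2r ?ler_nat// divr_ge0// sqr_ge0.
    by rewrite natrM; move: etaN; lra.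
  have e2 : (1 + eta) ^+ d o <= 2 ^+ d o.
    by rewrite lerXn2r ?nnegrE ?addr_ge0//; lra.
  have e3 : B <= D * 4 `^ theta * n%:R `^ (2 * l%:R * theta).
    rewrite /B -mulrA ler_wpM2l ?(ltW D0)//.
    have -> : n%:R `^ (2 * l%:R * theta) = N%:R `^ theta.
      by rewrite /N natrX -powR_mulrn// -powRrM natrM.
    rewrite -powRM// -natrM ge0_ler_powR ?nnegrE ?(ltW theta0)// ler_nat.
    exact: aux1 nd nN.
  have e4 : n%:R ^+ s <= (1 + eta) ^+ r.
    rewrite /r mulnC exprM lerXn2r ?nnegrE ?exprn_ge0 ?addr_ge0//.
    have -> : n%:R = eta * (n ^ l.+1)%:R.
      by rewrite /eta natrX exprSr; field; rewrite expf_neq0// gt_eqF.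
    move: (n ^ l.+1)%N => q; elim: q => [|q IH]; first by rewrite mulr0 expr0.
    rewrite exprS -addn1 natrD mulrDr mulr1.
    have : 1 <= (1 + eta) ^+ q by rewrite exprn_ege1// lerDl.
    move: IH; move: (_ ^+ q) => w; nra.
  apply: le_trans e4.
  apply: (@le_trans _ _ (4 * (expR 1 * (2 ^+ d o / (m o)%:num))
      * (D * 4 `^ theta * n%:R `^ (2 * l%:R * theta)))).
    apply: ler_pM => //.
    - by rewrite !mulr_ge0 ?invr_ge0 ?exprn_ge0 ?addr_ge0// divr_ge0// sqr_ge0.
    - by rewrite mulr_ge0 ?powR_ge0// ltW.
    - rewrite ler_wpM2l//; apply: ler_pM => //.
      + by rewrite exprn_ge0// addr_ge0// divr_ge0// sqr_ge0.
      + by rewrite divr_ge0// exprn_ge0// addr_ge0.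
      + by rewrite ler_wpM2r// invr_ge0.
  rewrite mulrA -/K1 -powR_mulrn//.
  have -> : s%:R = delta + 2 * l%:R * theta by rewrite /delta subrK.
  rewrite powRD; last by apply/implyP => _; rewrite gt_eqF.
  by rewrite ler_wpM2r ?powR_ge0.
have A8 : 0 < 8 * A by rewrite mulr_gt0.
have half := diag k./2.
have cE : (8 * (D * s%:R `^ theta))^-1 / n%:R `^ (l.+1%:R * theta) = (8 * A)^-1.
  by rewrite AE -invfM !mulrA.
have kk : (k./2 <= 2 * N)%N by exact: aux2.
have {half kk} := half kk.
rewrite cE -[in walk_kernel m b C o k o](odd_double_half k) addnn.
case: (odd k); rewrite /= ?add1n ?add0n => h.
  apply: le_trans (walk_kernel_lazy lf C0 degC o _).
  by rewrite -div1r ler_pdivrMr//; lra.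
by rewrite -div1r ler_pdivrMr//; lra.
Unshelve. all: by end_near. Qed.

End ReturnProbability.

(** * The Banach space of p-summable functions *)

Section EllpComplete.
Context {R : realType} {X : countType} (m : X -> {posnum R}).
Context (p : R) (p1 : 1 <= p).
Implicit Types (phi psi : X -> R) (A : {fset X}).

Let p_gt0 : 0 < p. Proof. exact: lt_le_trans p1. Qed.

Lemma le_psum phi psi : (forall x, `|phi x| <= `|psi x|) ->
  (psum m p phi <= psum m p psi)%E.
Proof.
move=> h; apply: le_esum => x _; rewrite lee_fin ler_wpM2r//.
by rewrite ge0_ler_powR ?nnegrE// ltW.
Qed.

Lemma fsum_le_psum A phi :
  ((\sum_(x <- A) `|phi x| `^ p * (m x)%:num)%:E <= psum m p phi)%E.
Proof.
apply: esum_ge; exists [set` A]; first by split; first exact: finite_fset.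
by rewrite -fsbig_seq//= sumEFin.
Qed.

Lemma psum_le_fsum phi (M : \bar R) :
  (forall A, (\sum_(x <- A) `|phi x| `^ p * (m x)%:num)%:E <= M)%E ->
  (psum m p phi <= M)%E.
Proof.
move=> h; apply: ge_ereal_sup => _ [A [finA _] <-].
by rewrite fsbig_finite//= sumEFin.
Qed.

Lemma ellp_norm_le phi e : 0 <= e -> (psum m p phi <= (e `^ p)%:E)%E ->
  phi \in ellp_pred m p /\ ellp_norm m p phi <= e.
Proof.
move=> e0 h; have hin : phi \in ellp_pred m p by apply: (le_lt_trans h); rewrite ltry.
split=> //; rewrite /ellp_norm -[leRHS](_ : (e `^ p) `^ p^-1 = e).
  apply: ge0_ler_powR; rewrite ?nnegrE ?invr_ge0 ?(ltW p_gt0) ?powR_ge0//.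
    exact: fine_psum_ge0.
  by rewrite -lee_fin fine_psumK.
by rewrite -powRrM mulfV ?gt_eqF// powRr1.
Qed.

Lemma psum_le_norm phi e : phi \in ellp_pred m p -> ellp_norm m p phi <= e ->
  (psum m p phi <= (e `^ p)%:E)%E.
Proof.
move=> hin h; rewrite -(fine_psumK hin) lee_fin -(ellp_normX m p1).
have n0 : 0 <= ellp_norm m p phi by exact: powR_ge0.
by rewrite ge0_ler_powR ?nnegrE ?(ltW p_gt0)// (le_trans n0).
Qed.

Lemma ellp_eval_le phi x : phi \in ellp_pred m p ->
  `|phi x| <= (m x)%:num `^ (- p^-1) * ellp_norm m p phi.
Proof.
move=> hin; have := fsum_le_psum [fset x]%fset phi.
rewrite big_seq_fset1 -(fine_psumK hin) lee_fin -(ellp_normX m p1) => h.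
have n0 : 0 <= ellp_norm m p phi by exact: powR_ge0.
rewrite powRN ler_pdivlMl ?powR_gt0//.
have mE : ((m x)%:num `^ p^-1) `^ p = (m x)%:num.
  by rewrite -powRrM mulVf ?gt_eqF// powRr1.
rewrite leNgt; apply/negP => lt.
have := gt0_ltr_powR p_gt0 _ _ lt.
rewrite !nnegrE n0 mulr_ge0 ?powR_ge0// => /(_ isT isT).
by rewrite powRM ?powR_ge0// mE mulrC ltNge h.
Qed.

Let cut A phi x := if x \in A then phi x else 0.

Let psum_cut A phi :
  psum m p (cut A phi) = (\sum_(x <- A) `|phi x| `^ p * (m x)%:num)%:E.
Proof.
have cutE : \sum_(x <- A) `|cut A phi x| `^ p * (m x)%:num
    = \sum_(x <- A) `|phi x| `^ p * (m x)%:num.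
  by rewrite !big_seq; apply: eq_bigr => x xA; rewrite /cut xA.
apply/eqP; rewrite eq_le -{2}cutE fsum_le_psum andbT.
apply: psum_le_fsum => B; rewrite lee_fin -cutE.
apply: (@le_trans _ _ (\sum_(x <- (A `|` B)%fset)
    `|cut A phi x| `^ p * (m x)%:num)).
  apply: ler_sum_fset; first exact: fsubsetUr.
  by move=> x; rewrite mulr_ge0 ?powR_ge0.
rewrite le_eqVlt; apply/orP; left; apply/eqP/esym/big_fset_incl.
  exact: fsubsetUl.
by move=> x _ xA; rewrite /cut (negbTE xA) normr0 powR0 ?mul0r// gt_eqF.
Qed.

Let cut_in A phi : cut A phi \in ellp_pred m p.
Proof. by rewrite unfold_in psum_cut ltry. Qed.

(** A pointwise limit stays in a closed ball: a form of Fatou's lemma. *)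
Lemma ellp_fatou (F : set_system (ellp m p1)) (FF : ProperFilter F)
    (w : X -> R) (phi0 : ellp m p1) e :
  (forall x, (phi : ellp m p1) x @[phi --> F] --> w x) ->
  F [set phi | `|phi - phi0| <= e] ->
  (psum m p (w - phi0)%R <= (e `^ p)%:E)%E.
Proof.
move=> Fw Fe.
have e0 : 0 <= e by have [phi] := filter_ex Fe; exact: le_trans.
apply: psum_le_fsum => A; rewrite -psum_cut; apply: psum_le_norm; first exact: cut_in.
pose n1 := ellp_norm m p (cut A (fun=> 1)).
have n10 : 0 <= n1 by exact: powR_ge0.
apply/ler_addgt0Pr => e' e'0; pose dl := e' / (n1 + 1).
have dl0 : 0 < dl by rewrite divr_gt0// ltr_wpDl.
have near_w : \forall phi \near F, forall x, x \in A -> `|w x - (phi : ellp m p1) x| <= dl.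
  have : \forall phi \near F, forall x, x \in enum_fset A ->
      `|w x - (phi : ellp m p1) x| <= dl.
    elim: (enum_fset A) => [|x s IH]; first by apply: nearW => phi x.
    have /cvgrPdist_le/(_ _ dl0) := Fw x.
    move: IH; apply: filterS2 => phi IH h y.
    by rewrite inE => /predU1P[->|/IH].
  by [].
have [phi [/= h1 h2]] := filter_ex (filterI near_w Fe).
have -> : cut A (w - phi0) = cut A (w - phi) + cut A (phi - phi0 : X -> R).
  apply/funext => x; rewrite /cut !fctE; case: ifPn => _; rewrite ?addr0// ?fctE.
  by rewrite addrA subrK.
apply: le_trans (ellp_normD p1 (cut_in _ _) (cut_in _ _)) _.
rewrite [leRHS]addrC; apply: lerD.
  have [_] : cut A (w - phi) \in ellp_pred m p
      /\ ellp_norm m p (cut A (w - phi)) <= dl * n1.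
    apply: ellp_norm_le; first by rewrite mulr_ge0// ltW.
    have -> : dl * n1 = ellp_norm m p (dl *: cut A (fun=> 1)).
      by rewrite (ellp_normZ p1)// gtr0_norm.
    apply: le_trans (psum_le_norm _ (lexx _)); last first.
      exact/ellp_predZ/cut_in.
    apply: le_psum => x; rewrite /cut !fctE; case: ifPn => [xA|_].
      by rewrite /GRing.scale /= mulr1 (gtr0_norm dl0); exact: h1.
    by rewrite normr0.
  move=> /le_trans; apply; rewrite /dl mulrAC ler_pdivrMr ?ltr_wpDl//.
  by rewrite ler_pM2l// lerDl.
apply: (le_trans _ h2); rewrite ellp_normE.
have [_] : cut A (phi - phi0 : X -> R) \in ellp_pred m p
  /\ ellp_norm m p (cut A (phi - phi0 : X -> R)) <= ellp_norm m p (phi - phi0).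
  apply: ellp_norm_le; first exact: powR_ge0.
  apply: le_trans (psum_le_norm (ellp_funP _) (lexx _)).
  apply: le_psum => x; rewrite /cut; case: ifPn => // _.
  by rewrite normr0.
by [].
Qed.

(** The limit is found pointwise, as evaluations are bounded functionals. *)
Lemma ellp_cauchy_cvg (F : set_system (ellp m p1)) :
  ProperFilter F -> cauchy F -> cvg F.
Proof.
move=> FF /cauchyP Fc.
have wP x : cvg ((phi : ellp m p1) x @[phi --> F]).
  apply: (cauchy_cvg _ (cauchy_exP _ _)) => e e0.
  pose K := (m x)%:num `^ (- p^-1).
  have K0 : 0 < K by rewrite powR_gt0.
  have [phi0 h] := Fc (e / K) (divr_gt0 e0 K0).
  exists (phi0 x).
  suff : F [set phi : ellp m p1 | ball (phi0 x) e (phi x)] by [].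
  move: h; apply: filterS => phi.
  rewrite -!ball_normE /= ltr_pdivlMr// mulrC; apply: le_lt_trans.
  exact: (@ellp_eval_le (phi0 - phi) x (ellp_funP _)).
pose w x := lim ((phi : ellp m p1) x @[phi --> F]).
have Fw x : (phi : ellp m p1) x @[phi --> F] --> w x by exact: wP.
have close (phi0 : ellp m p1) (e : R) : F (ball phi0 e) -> (psum m p (w - phi0)%R <= (e `^ p)%:E)%E.
  move=> Fb; apply: ellp_fatou Fw _; move: Fb; apply: filterS => phi.
  by rewrite -ball_normE /= distrC => /ltW.
have w_in : w \in ellp_pred m p.
  have [phi0 /close h] := Fc 1 ltr01.
  rewrite -(subrK (phi0 : X -> R) w); apply: (ellp_predD p1); last exact: ellp_funP.
  by apply: (le_lt_trans h); rewrite ltry.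
apply/cvg_ex; exists (Ellp p1 w_in); apply/cvgrPdist_le => e e0.
have e20 : 0 < e / 2 by rewrite divr_gt0.
have [phi0 h] := Fc (e / 2) e20.
move: (h); apply: filterS => phi; rewrite -ball_normE /= => hphi.
rewrite -(subrK phi0 (Ellp p1 w_in)) -addrA [leRHS]splitr.
apply: le_trans (ler_normD _ _) _; apply: lerD; last exact: ltW.
have [_] := ellp_norm_le (ltW e20) (close _ _ h).
by rewrite ellp_normE.
Qed.

HB.instance Definition _ := Uniform_isComplete.Build (ellp m p1) ellp_cauchy_cvg.

Lemma ellp_eval_cvg (S : (ellp m p1) ^nat) (l : ellp m p1) x :
  S n @[n --> \oo] --> l -> S n x @[n --> \oo] --> l x.
Proof.
move=> Sl; apply/cvgrPdist_le => e e0; pose K := (m x)%:num `^ (- p^-1).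
have K0 : 0 < K by rewrite powR_gt0.
move/cvgrPdist_le : Sl => /(_ (e / K) (divr_gt0 e0 K0)); apply: filterS => n.
rewrite ler_pdivlMr// mulrC; apply: le_trans.
exact: (@ellp_eval_le (l - S n) x (ellp_funP _)).
Qed.

End EllpComplete.

(** * The heat semigroup as a Poisson average of the lazy walk *)

Section HeatPoisson.
Context {R : realType} {X : countType} (m : X -> {posnum R}) (b : graph R X).
Context (p : R) (p1 : 1 <= p).
Context (C : R) (lf : locally_finite b) (C0 : 0 < C).
Context (degC : forall x, deg b m x <= C / 2).
Implicit Types (phi psi : ellp m p1).

Local Notation W := (walk m b C).

Let p_gt0 : 0 < p. Proof. exact: lt_le_trans p1. Qed.

(** The binomial formula for [(1 - Q) ^ k]. *)
Lemma iter_walk_alternating (h : X -> R) k x :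
  iter k (fun g y => g y - W g y) h x
    = \sum_(0 <= j < k.+1) 'C(k, j)%:R * (-1) ^+ j * iter j W h x.
Proof.
have walk_sum (c : nat -> R) n y :
    W (fun z => \sum_(0 <= j < n) c j * iter j W h z) y
      = \sum_(0 <= j < n) c j * iter j.+1 W h y.
  elim: n => [|n IH].
    by under eq_fun do rewrite big_nil; rewrite big_nil (walk_cst _ _ _ 0).
  under eq_fun do rewrite big_nat_recr//= addrC.
  by rewrite (walk_linear m lf C0) IH big_nat_recr//= addrC.
elim: k x => [|k IH] x; first by rewrite big_nat1 bin0 expr0 !mul1r.
rewrite iterS (_ : iter k _ h = fun y => \sum_(0 <= j < k.+1)
  'C(k, j)%:R * (-1) ^+ j * iter j W h y); last by apply/funext => y; exact: IH.
rewrite walk_sum [RHS]big_nat_recl//.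
under [X in _ = _ + X]eq_bigr => j _ do
  rewrite binS natrD !mulrDl.
rewrite big_split/= addrA; congr (_ + _).
  rewrite big_nat_recl// bin0 bin0; congr (_ + _).
  by rewrite [RHS]big_nat_recr//= bin_small// !mul0r addr0.
by rewrite -sumrN; apply: eq_bigr => j _; rewrite exprS; ring.
Qed.

(** The [l^p] contraction property: Jensen's inequality for [t ^ p], and
    invariance of [m] under the walk, tested on finite sets. *)
Lemma psum_walk_le (h : X -> R) : (psum m p (W h) <= psum m p h)%E.
Proof.
have := @convex_powR R p p1; set f := (@powR R ^~ p) => cf.
have f0 s : 0 <= s -> 0 <= f s by move=> _; exact: powR_ge0.
have f00 : f 0 = 0 by rewrite /f powR0// gt_eqF.
pose g x := `|h x| `^ p.
have g0 x : 0 <= g x by exact: powR_ge0.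
have pointwise x : `|W h x| `^ p <= W g x.
  apply: (@le_trans _ _ (f (W (fun y => `|h y|) x))).
    rewrite /f ge0_ler_powR ?nnegrE ?(ltW p_gt0)//.
      by apply: (walk_ge0 lf C0 degC) => y.
    rewrite ler_norml; apply/andP; split.
      have -> : - W (fun y => `|h y|) x = W (fun y => -1 * `|h y| + 0) x.
        by rewrite (walk_linear m lf C0) (walk_cst _ _ _ 0); ring.
      apply: (le_walk lf C0 degC) => y.
      by rewrite addr0 mulN1r lerNl -normrN ler_norm.
    by apply: (le_walk lf C0 degC) => y; exact: ler_norm.
  exact: (walk_jensen lf C0 degC cf f0 f00 (fun y => normr_ge0 (h y))).
apply: psum_le_fsum => A.
pose one x : R := (x \in A)%:R.
have oneA : supported_in A one by move=> x /negbTE xA; rewrite /one xA.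
have oneW := supported_walk m lf C0 oneA.
apply: (@le_trans _ _ (pairing m one (W g))%:E).
  rewrite lee_fin (pairingE _ _ oneA) !big_seq; apply: ler_sum => x xA.
  by rewrite /one xA mul1r mulrC ler_wpM2l.
rewrite -(pairing_walk m lf C0 _ oneA) (pairingE _ _ oneW).
apply: le_trans (fsum_le_psum m p (fneighbourhood b A) h).
rewrite lee_fin; apply: ler_sum => x _; rewrite mulrC ler_wpM2r//.
rewrite ler_piMl//.
have <- : W (fun=> 1) x = 1 by rewrite walk_cst.
by apply: (le_walk lf C0 degC) => y; rewrite /one; case: (y \in A).
Qed.

Lemma walk_in_ellp phi : W phi \in ellp_pred m p.
Proof. exact: le_lt_trans (psum_walk_le phi) (ellp_funP phi). Qed.

Definition walk_op phi : ellp m p1 := Ellp p1 (walk_in_ellp phi).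

Lemma normr_walk_op_le phi : `|walk_op phi| <= `|phi|.
Proof.
have [] // := @ellp_norm_le R X m p p1 (W phi) `|phi| (normr_ge0 _).
apply: le_trans (psum_walk_le phi) _.
by apply: psum_le_norm => //; exact: ellp_funP.
Qed.

Lemma lap_opE phi : lap_op b phi = C *: (phi - walk_op phi).
Proof.
apply/val_inj; rewrite /lap_op /to_ellp.
have E : laplacian b m phi = C *: (phi - walk_op phi) :> (X -> R).
  by apply/funext => x; rewrite (laplacian_walk m b C0).
rewrite insubdK E//; exact: (ellp_funP (C *: (phi - walk_op phi))).
Qed.

Lemma iter_lap_opE k phi x : iter k (lap_op b) phi x
  = C ^+ k * iter k (fun g y => g y - W g y) phi x.
Proof.
elim: k x => [|k IH] x; first by rewrite expr0 mul1r.
rewrite [in LHS]iterS [in RHS]iterS lap_opE.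
have -> : (C *: (iter k (lap_op b) phi - walk_op (iter k (lap_op b) phi))) x
    = C * (iter k (lap_op b) phi x - W (iter k (lap_op b) phi) x) by [].
have -> : ellp_fun (iter k (lap_op b) phi)
    = fun y => C ^+ k * iter k (fun g y => g y - W g y) phi y + 0.
  by apply/funext => y; rewrite addr0 IH.
by rewrite (walk_linear m lf C0) (walk_cst _ _ _ 0) exprS; ring.
Qed.

Lemma normr_iter_lap_op_le k phi : `|iter k (lap_op b) phi| <= (2 * C) ^+ k * `|phi|.
Proof.
elim: k => [|k IH]; first by rewrite expr0 mul1r.
rewrite iterS; move: (iter k _ _) IH => psi IH.
rewrite lap_opE normrZ (gtr0_norm C0) exprS -mulrA.
apply: (@le_trans _ _ (2 * C * `|psi|)); last by rewrite ler_pM2l// mulr_gt0.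
rewrite [2 * C]mulrC -[leRHS]mulrA (ler_pM2l C0).
apply: (le_trans (ler_normB psi (walk_op psi))).
by rewrite mulr_natl mulr2n lerD2l; exact: normr_walk_op_le.
Qed.

Lemma is_cvg_heat_series t phi :
  cvgn (series (fun k => ((- t) ^+ k / k`!%:R) *: iter k (lap_op b) phi)).
Proof.
apply: normed_cvg.
apply: (@series_le_cvg _ _ (`|phi| *: exp_coeff (`|t| * (2 * C)))).
- by move=> n; exact: normr_ge0.
- move=> n; rewrite mulr_ge0// exp_coeff_nneg//.
  by rewrite !mulr_ge0// ltW.
- move=> n /=; rewrite normrZ.
  have -> : `|(- t) ^+ n / n`!%:R| = exp_coeff `|t| n.
    by rewrite -(normrN t); exact: (@normr_exp_coeff R (- t) n).
  apply: (@le_trans _ _ (exp_coeff `|t| n * ((2 * C) ^+ n * `|phi|))).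
    by apply: ler_wpM2l; [exact: exp_coeff_nneg|exact: normr_iter_lap_op_le].
  have -> : (`|phi| *: exp_coeff (`|t| * (2 * C))) n
      = `|phi| * exp_coeff (`|t| * (2 * C)) n by [].
  rewrite /exp_coeff /= [(`|t| * _) ^+ n]exprMn; move: `|phi| => z.
  by rewrite le_eqVlt; apply/orP; left; apply/eqP; ring.
- by apply: is_cvg_seriesZ; exact: is_cvg_series_exp_coeff.
Qed.

(** As [L = C (1 - Q)], the semigroup is [exp (- C t) exp (C t Q)].  This form
    shows its positivity and conservativeness, which the alternating exponential
    series hides. *)
Lemma heat_poisson t phi K x : (forall y, `|phi y| <= K) ->
  heat b t phi x = poisson_avg (C * t) (fun k => iter k W phi x).
Proof.
move=> phiK; have zK k : `|iter k W phi x| <= K.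
  exact: (normr_iter_walk_le lf C0 degC).
have h1 := @ellp_eval_cvg R X m p p1 _ _ x (@is_cvg_heat_series t phi).
have h2 := @poisson_avg_alternating R (C * t) _ K zK.
move: h2; set u := series _.
suff -> : u = (fun n => series (fun k =>
    ((- t) ^+ k / k`!%:R) *: iter k (lap_op b) phi) n x).
  by move=> h2; exact: (cvg_unique _ h1 h2).
apply/funext => n; rewrite /u !seriesEnat /=.
have evalD : forall s : seq nat, (\sum_(k <- s)
    ((- t) ^+ k / k`!%:R) *: iter k (lap_op b) phi) x
    = \sum_(k <- s) ((- t) ^+ k / k`!%:R) * iter k (lap_op b) phi x.
  by elim=> [|k s IH]; rewrite ?big_nil// !big_cons -IH.
rewrite evalD; apply: eq_bigr => k _.
rewrite iter_lap_opE iter_walk_alternating /exp_coeff /= -mulrN.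
by rewrite [(C * _) ^+ k]exprMn; ring.
Qed.

End HeatPoisson.

(** * Bounded functionals and the Bochner integral *)

(** Monotonicity for functions that need not be measurable: the integral of a
    nonnegative function is a supremum over the simple functions below it. *)
Lemma ge0_le_integral_cond d (T : measurableType d) (R : realType)
    (mu : {measure set T -> \bar R}) (D E : set T) (f g : T -> \bar R) :
  E `<=` D -> (forall x, E x -> 0 <= f x)%E -> (forall x, D x -> 0 <= g x)%E ->
  (forall x, E x -> f x <= g x)%E ->
  (\int[mu]_(x in E) f x <= \int[mu]_(x in D) g x)%E.
Proof.
move=> ED f0 g0 fg; rewrite !ge0_integralE//; apply: le_ereal_sup => _ [h hf <-].
exists h => // x; apply: (le_trans (hf x)); rewrite /patch.
case: ifPn => [|_].
  by rewrite inE => Ex; rewrite mem_set ?fg//; exact: ED.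
by case: ifPn => // /[1!inE] /g0.
Qed.

Section BochnerFunctional.
Context d (T : measurableType d) (R : realType) (mu : {measure set T -> \bar R}).
Context (V : normedModType R) (D : set T) (mD : measurable D).
Context (l : V -> R) (K : R).
Hypothesis l_linear : forall a u w, l (a *: u + w) = a * l u + l w.
Hypothesis K0 : 0 < K.
Hypothesis l_le : forall u, `|l u| <= K * `|u|.

Let l0 : l 0 = 0.
Proof. by have := l_linear (-1) 0 0; rewrite scaler0 addr0; lra. Qed.

Let lB u w : l (u - w) = l u - l w.
Proof. by rewrite addrC -scaleN1r l_linear; ring. Qed.

Let l_sum (I : Type) (r : seq I) (a : I -> R) (u : I -> V) :
  l (\sum_(i <- r) a i *: u i) = \sum_(i <- r) a i * l (u i).
Proof. by elim: r => [|i r IH]; rewrite ?big_nil// !big_cons l_linear IH. Qed.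

Let l_cvg (u : V ^nat) v : u n @[n --> \oo] --> v -> l (u n) @[n --> \oo] --> l v.
Proof.
move=> uv; apply/cvgrPdist_le => e e0.
move/cvgrPdist_le : uv => /(_ (e / K) (divr_gt0 e0 K0)); apply: filterS => n.
rewrite ler_pdivlMr// mulrC -lB; exact: le_trans.
Qed.

Let simple_measurable (E : set T) s : E `<=` D -> measurable E ->
  integrable_simple mu D s -> measurable_fun E (l \o s).
Proof.
move=> ED mE [fin_s ms _] _ Y mY.
have -> : E `&` (l \o s) @^-1` Y
    = E `&` \bigcup_(v in range s `&` l @^-1` Y) (D `&` s @^-1` [set v]).
  apply/seteqP; split=> [x [Ex /= Yx]|x [Ex [v [_ Yv] [_ sx]]]].
    by split=> //; exists (s x); split=> //; exact: ED.
  by split=> //=; rewrite sx.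
apply: measurableI => //; apply: fin_bigcup_measurable => [|v _]; last exact: ms.
exact: finite_setIl.
Qed.

Let simple_integrable (N : set T) s : measurable N -> mu N = 0%E ->
  integrable_simple mu D s ->
  mu.-integrable (D `\` N) (EFin \o (l \o s)) /\
  (\int[mu]_(x in D `\` N) (l (s x))%:E = (l (simple_integral mu D s))%:E)%E.
Proof.
move=> mN N0 [fin_s ms mfin]; set E := D `\` N.
have mE : measurable E by exact: measurableD.
pose A v := D `&` s @^-1` [set v].
pose F := fset_set (range s).
have sE x : E x -> (l (s x))%:E = (\sum_(v <- F) (l v)%:E * (\1_(A v) x)%:E)%E.
  move=> [Dx _]; have sF : s x \in F by rewrite in_fset_set// inE.
  rewrite (big_fsetD1 (s x))//= big1_seq ?adde0.
    by rewrite /indic /A mem_set//= mule1.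
  move=> v /=; rewrite in_fsetD1 => /andP[vs _].
  by rewrite /indic /A memNset ?mule0// => -[_ /= sv]; rewrite sv eqxx in vs.
have term v : mu.-integrable E (fun x => (l v)%:E * (\1_(A v) x)%:E)%E /\
    (\int[mu]_(x in E) ((l v)%:E * (\1_(A v) x)%:E) = (fine (mu (A v)) * l v)%:E)%E.
  have [->|v0] := eqVneq v 0.
    rewrite (_ : (fun x => _) = cst 0%E); last first.
      by apply/funext => x; rewrite l0 mul0e.
    by rewrite l0 mulr0; split; [exact: integrable0|exact: integral0].
  have mAv : measurable (A v) by exact: ms.
  have muA : (mu (A v) < +oo)%E by exact: mfin.
  have muAE : mu (A v `&` E) = mu (A v).
    rewrite /E setIDA (_ : A v `&` D = A v); last by rewrite /A setIAC setIid.
    rewrite measureD//.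
    rewrite [X in (_ - X)%E](_ : _ = 0%E) ?sube0//.
    apply/eqP; rewrite eq_le measure_ge0 andbT -N0 le_measure ?inE//.
    exact: measurableI.
  have iA : mu.-integrable E (fun x => (\1_(A v) x)%:E).
    apply/integrableP; split.
      by apply/measurable_EFinP; exact: measurable_indic.
    under eq_integral do rewrite gee0_abs ?lee_fin//.
    by rewrite integral_indic// muAE.
  split; first exact: integrableZl.
  by rewrite integralZl// integral_indic// muAE -[mu (A v)]fineK ?ge0_fin_numE// -EFinM mulrC.
split.
  have := @integrable_sum _ _ _ mu E mE _ F xpredT
    (fun v x => (l v)%:E * (\1_(A v) x)%:E)%E (fun v _ => (term v).1).
  by apply: eq_integrable => // x; rewrite inE => Ex; rewrite /= sE.
rewrite (eq_integral (fun x => \sum_(v <- F) (l v)%:E * (\1_(A v) x)%:E)%E); last first.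
  by move=> x; rewrite inE => Ex; rewrite sE.
rewrite integral_sum//; last by move=> v; exact: (term v).1.
under eq_bigr do rewrite (term _).2.
rewrite sumEFin /simple_integral (fsbig_finite _ _ fin_s)/= l_sum.
by [].
Qed.

(** Only almost everywhere strong measurability is available for [g], hence
    the null set [N]: off [N], the integrand [l \o g] is a limit of measurable
    functions. *)
Lemma bochner_functional (g : T -> V) (v : V) :
  is_bochner_integral mu D g v ->
  exists N, [/\ measurable N, mu N = 0%E,
    mu.-integrable (D `\` N) (EFin \o (l \o g)) &
    (\int[mu]_(x in D `\` N) (l (g x))%:E = (l v)%:E)%E].
Proof.
move=> [s [[simp [N [mN N0 sN]] L1] sv]]; exists N.
set E := D `\` N; have mE : measurable E by exact: measurableD.
have ED : E `<=` D by exact: subDsetl.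
have ms n : measurable_fun E (l \o s n) by exact: simple_measurable.
have lim_g x : E x -> s n x @[n --> \oo] --> g x.
  move=> [Dx Nx]; apply: contrapT => ns; apply: Nx; apply: sN => /= h.
  exact: ns (h Dx).
have mg : measurable_fun E (l \o g).
  by apply: (measurable_fun_cvg ms) => x Ex; apply: l_cvg; exact: lim_g.
pose err n := (\int[mu]_(x in E) `|(l (g x) - l (s n x))%:E|)%E.
have err_le n : (err n <= K%:E * \int[mu]_(x in D) `|g x - s n x|%R%:E)%E.
  rewrite -lee_pdivrMl// /err -ge0_integralZl//.
  - apply: ge0_le_integral_cond => // x _.
      by rewrite mule_ge0// lee_fin ltW// invr_gt0.
    by rewrite lee_fin ler_pdivrMl// -lB.
  - apply/measurableT_comp => //; apply/measurable_EFinP.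
    exact: (measurable_funB mg (ms n)).
  - by rewrite lee_fin ltW// invr_gt0.
have err0 : err n @[n --> \oo] --> 0%E.
  have L1' : (K%:E * \int[mu]_(x in D) `|g x - s n x|%R%:E)%E @[n --> \oo] --> 0%E.
    by rewrite -(mule0 K%:E); apply: cvgeZl.
  apply: (squeeze_cvge _ _ L1'); last exact: cvg_cst.
  by apply: nearW => n; rewrite err_le integral_ge0.
have err_lt e : 0 < e -> \forall n \near \oo, (err n < e%:E)%E.
  move=> e0; have /fine_cvgP[fin /cvgrPdist_lt/(_ e e0)] := err0.
  move: fin; apply: filterS2 => n fin.
  rewrite sub0r normrN -lte_fin => /(le_lt_trans _); apply.
  by rewrite -[leLHS](fineK fin) lee_fin ler_norm.
have mgs n : measurable_fun E (fun x => (l (g x) - l (s n x))%:E).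
  by apply/measurable_EFinP; exact: (measurable_funB mg (ms n)).
have int_s n := (simple_integrable mN N0 (simp n)).1.
have int_gs : \forall n \near \oo,
    mu.-integrable E (fun x => (l (g x) - l (s n x))%:E).
  by move: (err_lt 1 ltr01); apply: filterS => n en; apply/integrableP; split=> //; exact: lt_trans en (ltry _).
have int_g : mu.-integrable E (EFin \o (l \o g)).
  have [n _ h] := int_gs; have := integrableD mE (h n (leqnn n)) (int_s n).
  by apply: eq_integrable => // x _ /=; rewrite -EFinD subrK.
split=> //.
pose I := fine (\int[mu]_(x in E) (l (g x))%:E).
have IE : (\int[mu]_(x in E) (l (g x))%:E = I%:E)%E.
  by rewrite fineK//; exact: integrable_fin_num.
rewrite IE; congr EFin; apply: (cvg_unique _ _ (l_cvg sv)) => //.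
apply/cvgrPdist_le => e e0.
move: (err_lt e e0); apply: filterS => n en.
rewrite -lee_fin; apply: le_trans (ltW en).
have -> : (`|I - l (simple_integral mu D (s n))|%:E
    = `| \int[mu]_(x in E) (l (g x) - l (s n x))%:E |)%E.
  under eq_integral do rewrite EFinB.
  rewrite (@integralB_EFin _ _ _ mu E (l \o g) (l \o s n) mE int_g (int_s n)).
  by rewrite IE (simple_integrable mN N0 (simp n)).2 -EFinB abse_EFin.
exact: le_abse_integral.
Qed.

End BochnerFunctional.

(** * Comparison with the ordinary differential equation *)

Section Comparison.
Context {R : realType} (f : R -> R).
Hypothesis f_gt0 : forall s : R, 0 < s -> 0 < f s.
Hypothesis f_nd : forall x y : R, 0 <= x -> x <= y -> f x <= f y.

Local Notation mu := (@lebesgue_measure R).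

Let inv_f_ge0 (x s : R) : 0 < x -> `[x, +oo[%classic s -> 0 <= (f s)^-1.
Proof.
rewrite /= in_itv /= andbT => x0 xs; rewrite invr_ge0 ltW// f_gt0//.
exact: lt_le_trans xs.
Qed.

Let measurable_inv_f (x : R) : 0 < x ->
  measurable_fun (`[x, +oo[%classic : set R) (fun s => ((f s)^-1)%:E).
Proof.
move=> x0; apply/measurable_EFinP.
have : measurable_fun (`[x, +oo[%classic : set R)
    (fun s : R => (f (Num.max s x))^-1).
  apply: nonincreasing_measurable; first exact: measurable_itv.
  move=> s s' ss'.
  have pos r : 0 < Num.max r x by rewrite lt_max x0 orbT.
  rewrite lef_pV2 ?posrE ?f_gt0//; apply: f_nd; first exact: ltW.
  by rewrite ge_max !le_max ss' lexx orbT.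
apply: eq_measurable_fun => s.
by rewrite inE /= in_itv /= andbT => /max_idPl ->.
Qed.

Lemma tail_integral_ge0 (x : R) : 0 < x -> (0 <= tail_integral f x)%E.
Proof. by move=> x0; apply: integral_ge0 => s /(inv_f_ge0 x0). Qed.

Lemma tail_integral_step (x y : R) : 0 < x -> x <= y ->
  (((y - x) / f y)%R%:E + tail_integral f y <= tail_integral f x)%E.
Proof.
move=> x0 xy; rewrite [leRHS]/tail_integral.
have y0 : 0 < y by exact: lt_le_trans xy.
rewrite (@itv_bndbnd_setU _ _ _ (BLeft y)) ?bnd_simp//.
rewrite ge0_integral_setU//.
- rewrite leeD2r//.
  apply: (@le_trans _ _ (\int[mu]_(s in `[x, y[) cst ((f y)^-1)%:E s)%E).
    rewrite integral_cst//= lebesgue_measure_itv /= lte_fin.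
    case: ltP => [_|yx]; first by rewrite -EFinB -EFinM mulrC.
    by rewrite mule0 lee_fin (_ : y - x = 0) ?mul0r//; lra.
  apply: ge0_le_integral_cond => // s /=; rewrite in_itv /= => /andP[xs sy].
  - by rewrite lee_fin invr_ge0 ltW// f_gt0.
  - by rewrite lee_fin invr_ge0 ltW// f_gt0// (lt_le_trans x0).
  - have s0 : 0 < s by exact: lt_le_trans xs.
    rewrite lee_fin lef_pV2 ?posrE ?f_gt0//; apply: f_nd; exact: ltW.
- rewrite -itv_bndbnd_setU ?bnd_simp//; exact: measurable_inv_f.
- move=> s; rewrite -itv_bndbnd_setU ?bnd_simp// => /(inv_f_ge0 x0).
  by rewrite lee_fin.
- rewrite disj_set2E; apply/eqP/seteqP; split => // s /=.
  by rewrite !in_itv /= andbT => -[/andP[_ sy]]; rewrite leNgt sy.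
Qed.

Lemma tail_integral_antitone (x y : R) : 0 < x -> x <= y ->
  (tail_integral f y <= tail_integral f x)%E.
Proof.
move=> x0 xy; apply: le_trans (tail_integral_step x0 xy).
rewrite leeDr// lee_fin divr_ge0 ?subr_ge0// ltW// f_gt0//.
exact: lt_le_trans xy.
Qed.

(** A supersolution of [V' = f V] on [[0, T]] needs [V 0] to have lifetime at
    least [T].  Along a uniform partition into [n] pieces, the integral of [1 / f]
    exceeds the sum of the [T / n * (f (V i) / f (V (i + 1)))]; as
    [rho >= 1 + ln rho], this sum is at least [T] up to a telescoping term
    [O (1 / n)], so that no continuity of [V] is involved. *)
Lemma lifetime_le_tail_integral (V : R -> R) (T : R) : 0 < T -> 0 < V 0 ->
  (forall s s' : R, 0 <= s -> s <= s' -> s' <= T -> V s <= V s') ->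
  (forall s s' : R, 0 <= s -> s <= s' -> s' <= T ->
    (s' - s) * f (V s) <= V s' - V s) ->
  (T%:E <= tail_integral f (V 0%R))%E.
Proof.
move=> T0 V0 Vnd Vf.
have fV s : 0 <= s -> s <= T -> 0 < V s /\ 0 < f (V s).
  move=> s0 sT; have Vs : 0 < V s by apply: lt_le_trans (Vnd 0 s _ _ _).
  by split=> //; exact: f_gt0.
pose c := ln (f (V T)) - ln (f (V 0%R)).
have partition n : (0 < n)%N ->
    ((T - T / n%:R * c)%R%:E <= tail_integral f (V 0%R))%E.
  move=> n0; have nR : 0 < n%:R :> R by rewrite ltr0n.
  pose h := T / n%:R; have h0 : 0 < h by rewrite divr_gt0.
  have hn : n%:R * h = T by rewrite /h mulrC divfK ?gt_eqF.
  pose v k := V (k%:R * h).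
  have step k : (k <= n)%N ->
      ((k%:R * h + h * (ln (f (V 0)) - ln (f (v k))))%R%:E
        + tail_integral f (v k) <= tail_integral f (V 0%R))%E.
    elim: k => [_|k IH kn]; first by rewrite /v !mul0r subrr mulr0 addr0 add0e.
    apply: le_trans (IH (ltnW kn)); rewrite /v.
    set s := k%:R * h; set s' := k.+1%:R * h.
    have ss' : s' = s + h by rewrite /s' /s -natr1 mulrDl mul1r.
    have s0 : 0 <= s by rewrite mulr_ge0// ltW.
    have s'T : s' <= T by rewrite -hn ler_pM2r// ler_nat.
    have les : s <= s' by rewrite ss' lerDl ltW.
    have [Vs fs] := fV s s0 (le_trans les s'T).
    have [Vs' fs'] := fV s' (le_trans s0 les) s'T.
    have tail := tail_integral_step Vs (Vnd _ _ s0 les s'T).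
    apply: (@le_trans _ _ ((s + h * (ln (f (V 0)) - ln (f (V s))))%R%:E +
        (((V s' - V s) / f (V s'))%R%:E + tail_integral f (V s')))%E); last first.
      by rewrite leeD2l.
    rewrite [leRHS]addeA -EFinD; apply: leeD => //; rewrite lee_fin.
    have incr : h * f (V s) / f (V s') <= (V s' - V s) / f (V s').
      have e : s' - s = h by rewrite ss' addrAC subrr add0r.
      by rewrite ler_pM2r ?invr_gt0// -e; exact: Vf.
    have rho : 1 + (ln (f (V s)) - ln (f (V s'))) <= f (V s) / f (V s').
      rewrite -ln_div ?posrE//.
      rewrite -[leRHS]lnK ?posrE ?divr_gt0//; exact: expR_ge1Dx.
    have : h * (1 + (ln (f (V s)) - ln (f (V s')))) <= h * f (V s) / f (V s').
      by rewrite -mulrA ler_pM2l.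
    by move: incr ss'; clear tail rho; clearbody s s'; lra.
  have := step n (leqnn n); rewrite /v hn => /(le_trans _); apply.
  rewrite -[leLHS]adde0 leeD//.
    by rewrite lee_fin /c -/h; lra.
  by apply: tail_integral_ge0; have [] := fV T (ltW T0) (lexx T).
case E : (tail_integral f (V 0%R)) => [r| |]; last 2 first.
- by rewrite leey.
- by have := tail_integral_ge0 V0; rewrite E.
rewrite lee_fin leNgt; apply/negP => rT.
pose n := (Num.bound (T * `|c| / (T - r))).+1.
have dl : 0 < T - r by rewrite subr_gt0.
have hn : T * `|c| / (T - r) < n%:R.
  apply: lt_trans (archi_boundP _) _; last by rewrite ltr_nat.
  by rewrite divr_ge0 ?mulr_ge0 ?(ltW T0) ?(ltW dl).
have n0 : 0 < n%:R :> R by rewrite ltr0n.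
have := partition n (ltn0Sn _); rewrite E lee_fin.
rewrite ltr_pdivrMr// in hn.
have : T / n%:R * c < T - r; last by lra.
rewrite mulrAC ltr_pdivrMr// mulrC [ltRHS]mulrC.
apply: le_lt_trans hn; rewrite mulrC ler_pM2l//; exact: ler_norm.
Qed.

End Comparison.

(** * Lifetime of mild solutions *)

Section HeatValue.
Context {R : realType} {X : countType} (m : X -> {posnum R}) (b : graph R X).
Context (p : R) (p1 : 1 <= p).
Context (C : R) (lf : locally_finite b) (C0 : 0 < C).
Context (degC : forall x, deg b m x <= C / 2).
Context (c0 : R) (c0_gt0 : 0 < c0) (m_ge : forall x, c0 <= (m x)%:num).
Context (o : X).
Implicit Types (phi psi : ellp m p1).

Local Notation W := (walk m b C).

Let p_gt0 : 0 < p. Proof. exact: lt_le_trans p1. Qed.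

Lemma ellp_sup_le phi x : `|phi x| <= c0 `^ (- p^-1) * `|phi|.
Proof.
apply: le_trans (ellp_eval_le p1 x (ellp_funP phi)) _.
apply: ler_wpM2r; first exact: powR_ge0.
rewrite !powRN lef_pV2 ?posrE ?powR_gt0//.
by rewrite ge0_ler_powR ?nnegrE ?invr_ge0 ?(ltW p_gt0)// ltW.
Qed.

(** This is [(exp (- s L) phi) o], by [heat_poisson]. *)
Definition heat_value s phi := poisson_avg (C * s) (fun k => iter k W phi o).

Let iter_le phi k x : `|iter k W phi x| <= c0 `^ (- p^-1) * `|phi|.
Proof. by apply: (normr_iter_walk_le lf C0 degC) => y; exact: ellp_sup_le. Qed.

Let iter_cvg l phi x : cvgn (exp_series l (fun k => iter k W phi x)).
Proof. exact: (@is_cvg_exp_series _ _ _ _ (fun k => iter_le phi k x)). Qed.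

Lemma heat_value_linear s c phi psi :
  heat_value s (c *: phi + psi) = c * heat_value s phi + heat_value s psi.
Proof.
rewrite /heat_value -(poisson_avg_linear c (@iter_cvg _ phi o) (@iter_cvg _ psi o)).2.
congr poisson_avg; apply/funext => k.
by rewrite -(iter_walk_linear m lf C0).
Qed.

Lemma normr_heat_value_le s phi : 0 <= s ->
  `|heat_value s phi| <= c0 `^ (- p^-1) * `|phi|.
Proof.
move=> s0; apply: normr_poisson_avg_le => [|k]; last exact: iter_le.
by rewrite mulr_ge0// ltW.
Qed.

Lemma heat_value_heat s t phi : heat_value s (heat b t phi) = heat_value (s + t) phi.
Proof.
rewrite /heat_value mulrDr (poisson_avgD _ _ (fun k => iter_le phi k o)).
congr poisson_avg; apply/funext => k.
have [V hV] := walk_kernel_supported m lf C0 o k.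
rewrite -(pairing_walk_kernel m lf C0) (pairingE _ _ hV).
under eq_bigr => x _ do
  rewrite (heat_poisson lf C0 degC t x (ellp_sup_le phi)) mulrA.
rewrite -(poisson_avg_sum _ _ (fun x => @iter_cvg (C * t) phi x)).2.
congr poisson_avg; apply/funext => j.
rewrite iterD -(pairing_walk_kernel m lf C0) (pairingE _ _ hV).
by apply: eq_bigr => x _; rewrite mulrA.
Qed.

Let iter_ge0 phi k : (forall x, 0 <= phi x) -> 0 <= iter k W phi o.
Proof.
move=> phi0.
by have := le_iter_walk lf C0 degC k (phi := fun=> 0) phi0 o; rewrite iter_walk_cst.
Qed.

Lemma heat_value_ge0 s phi : 0 <= s -> (forall x, 0 <= phi x) ->
  0 <= heat_value s phi.
Proof.
move=> s0 phi0; rewrite -(poisson_avg_cst (C * s) 0).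
apply: le_poisson_avg => [||//|k]; last exact: iter_ge0.
  by rewrite mulr_ge0// ltW.
by apply: (@is_cvg_exp_series _ _ _ 0) => _; rewrite normr0.
Qed.

(** Jensen's inequality, for the probability measure that the heat kernel
    started at [o] defines at time [s]. *)
Lemma heat_value_jensen (f : R -> R) s phi psi :
  convex_function (`[0, +oo[%classic : set R^o) f ->
  (forall s, 0 <= s -> 0 <= f s) -> f 0 = 0 ->
  0 <= s -> (forall x, 0 <= phi x) -> (forall x, psi x = f (phi x)) ->
  f (heat_value s phi) <= heat_value s psi.
Proof.
move=> cf f0 f00 s0 phi0 psiE.
have [c hc] := supporting_line cf f0 f00 (heat_value_ge0 s0 phi0).
set z0 := heat_value s phi in hc *; pose e := f z0 - c * z0.
have ce : cvgn (exp_series (C * s) (fun=> e)).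
  by apply: (@is_cvg_exp_series _ _ _ `|e|).
have [cl le] := poisson_avg_linear c (@iter_cvg (C * s) phi o) ce.
have -> : f z0 = poisson_avg (C * s) (fun k => c * iter k W phi o + e).
  by rewrite le poisson_avg_cst -/(heat_value s phi) -/z0 /e addrC subrK.
apply: le_poisson_avg => //; first by rewrite mulr_ge0// ltW.
move=> k; have := le_iter_walk lf C0 degC k
  (phi := fun y => c * phi y + e) (psi := psi) _ o.
rewrite (iter_walk_linear m lf C0) iter_walk_cst; apply=> y.
by rewrite psiE; apply: le_trans (hc _ (phi0 y)); rewrite /e; lra.
Qed.

(** Fujita's argument: if [u] is a solution then, for a fixed [T], the function
    [V s = (exp (- (T - s) L) (u s)) o] satisfies [V' >= f V] in integrated form,
    by the semigroup law and Jensen's inequality. *)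
Lemma mild_solution_lifetime (f : R -> R) (a : ellp m p1) (u : R -> ellp m p1)
    (T : R) :
  convex_function (`[0, +oo[%classic : set R^o) f ->
  (forall s, 0 <= s -> 0 <= f s) -> f 0 = 0 -> (forall s, 0 < s -> 0 < f s) ->
  global_mild_solution b f a u -> 0 < T -> 0 < heat_value T a ->
  (T%:E <= tail_integral f (heat_value T a))%E.
Proof.
move=> cf f0 f00 fpos [u0 fu _ mild] T0 aT.
have f_nd := convex_nondecreasing cf f0 f00.
pose fu_op r : ellp m p1 := to_ellp m p1 (f \o u r).
have fuE r x : 0 < r -> fu_op r x = f (u r x).
  by move=> r0; rewrite /fu_op /to_ellp insubdK//; exact: fu.
have fu_ge0 r x : 0 < r -> 0 <= fu_op r x.
  by move=> r0; rewrite fuE// f0// u0// ltW.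
(* [G] is the integrand of the mild formula, seen through the functional. *)
pose G r := heat_value (T - r) (fu_op r).
pose V s := heat_value (T - s) (u s).
have key s : 0 <= s -> s <= T -> exists N, [/\ measurable N,
    lebesgue_measure N = 0%E,
    lebesgue_measure.-integrable (`]0%R, s]%classic `\` N) (EFin \o G) &
    (\int[lebesgue_measure]_(r in `]0%R, s]%classic `\` N) (G r)%:E
      = (V s - heat_value T a)%R%:E)%E].
  move=> s0 sT; have [v hv us] := mild s s0.
  have Ts : 0 <= T - s by rewrite subr_ge0.
  have K0 : 0 < c0 `^ (- p^-1) by rewrite powR_gt0.
  have mI : measurable (`]0%R, s]%classic : set (measurableTypeR R)).
    exact: measurable_itv.
  have [N [mN N0 iN eN]] := bochner_functional mI
    (heat_value_linear (T - s)) K0 (fun phi => normr_heat_value_le phi Ts) hv.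
  have GE r : heat_value (T - s) (heat b (s - r) (fu_op r)) = G r.
    by rewrite heat_value_heat addrA subrK.
  exists N; split=> //.
    move: iN; apply: eq_integrable => [|r _ /=]; first exact: measurableD.
    by rewrite GE.
  under eq_integral do rewrite -GE.
  rewrite eN /V us -[heat b s a]scale1r heat_value_linear mul1r heat_value_heat.
  by rewrite subrK addrAC subrr add0r.
have G_ge r : 0 < r -> r <= T -> f (V r) <= G r.
  move=> r0 rT; apply: heat_value_jensen => //.
  - by rewrite subr_ge0.
  - by move=> x; apply: u0; exact: ltW.
  - by move=> x; exact: fuE.
have G_ge0 r : 0 < r -> r <= T -> 0 <= G r.
  move=> r0 rT; apply: heat_value_ge0; first by rewrite subr_ge0.
  by move=> x; exact: fu_ge0.
(* The integrals over [(0, s]] and [(0, s']] come with their own null sets, which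
   are merged into [N2] before the integrals are subtracted. *)
have incr c s s' : 0 <= c -> 0 <= s -> s <= s' -> s' <= T ->
    (forall r, s < r -> r <= s' -> c <= G r) -> (s' - s) * c <= V s' - V s.
  move=> c_ge0 s0 ss' s'T cG.
  have [N [mN N0 iN eN]] := key s s0 (le_trans ss' s'T).
  have [N' [mN' N0' iN' eN']] := key s' (le_trans s0 ss') s'T.
  pose N2 := N `|` N'; have mN2 : measurable N2 by exact: measurableU.
  have null (A : set (measurableTypeR R)) : measurable A -> A `<=` N2 -> lebesgue_measure A = 0%E.
    by move=> mA AN; apply: (subset_measure0 mA mN2 AN); exact: null_set_setU.
  have shrink (t : R) (M : set (measurableTypeR R)) : measurable M -> M `<=` N2 ->
      lebesgue_measure.-integrable (`]0%R, t]%classic `\` M) (EFin \o G) ->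
      (\int[lebesgue_measure]_(r in `]0%R, t]%classic `\` M) (G r)%:E
        = \int[lebesgue_measure]_(r in `]0%R, t]%classic `\` N2) (G r)%:E)%E.
    move=> mM MN iM; rewrite (@negligible_integral _ _ _ _ _ N2)//.
    - by rewrite setDDl (_ : M `|` N2 = N2)//; exact: setUidr.
    - exact: measurableD.
    - exact: null.
  have e : (\int[lebesgue_measure]_(r in `]0%R, s']%classic `\` N2) (G r)%:E
      = (V s' - heat_value T a)%R%:E)%E.
    by rewrite -eN' -(shrink s' N')//; exact: subsetUr.
  have e' : (\int[lebesgue_measure]_(r in `]0%R, s]%classic `\` N2) (G r)%:E
      = (V s - heat_value T a)%R%:E)%E.
    by rewrite -eN -(shrink s N)//; exact: subsetUl.
  have split_itv : `]0%R, s']%classic `\` N2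
      = (`]0%R, s]%classic `\` N2) `|` (`]s, s']%classic `\` N2).
    rewrite -setDUl -itv_bndbnd_setU ?bnd_simp//.
  have mG : measurable_fun (`]0%R, s']%classic `\` N2) (EFin \o G).
    have /integrableP[mG _] := iN'; apply: measurable_funS mG.
      exact: measurableD.
    by apply: setDS; exact: subsetUr.
  move: e; rewrite split_itv ge0_integral_setU; first last.
  - rewrite disj_set2E; apply/eqP/seteqP; split => // r /= [[+ _] [+ _]].
    by rewrite !in_itv /= => /andP[_ rs] /andP[sr _]; move: sr; rewrite ltNge rs.
  - move=> r; rewrite -split_itv => -[+ _]; rewrite /= in_itv /= lee_fin.
    by move=> /andP[r0 rs']; apply: G_ge0 => //; exact: le_trans s'T.
  - by rewrite -split_itv.
  - exact: measurableD.
  - exact: measurableD.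
  rewrite e' => e2.
  have low : (((s' - s) * c)%R%:E <=
      \int[lebesgue_measure]_(r in `]s, s']%classic `\` N2) (G r)%:E)%E.
    have -> : ((s' - s) * c)%:E = (\int[lebesgue_measure]_(r in `]s, s']%classic `\` N2) cst c%:E r)%E.
      rewrite integral_cst//=; last exact: measurableD.
      have -> : lebesgue_measure (`]s, s']%classic `\` N2) = (s' - s)%:E.
        rewrite measureD//=.
          rewrite [X in (_ - X)%E]null//; last exact: measurableI.
          rewrite sube0 lebesgue_measure_itv /= lte_fin.
          case: ltP => [_|s's]; first by rewrite -EFinB.
          by rewrite (_ : s' - s = 0)//; apply/eqP; rewrite subr_eq0 eq_le s's.
        by rewrite lebesgue_measure_itv /= lte_fin; case: ifP => _; rewrite -?EFinB ltry.
      by rewrite -EFinM mulrC.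
    apply: ge0_le_integral_cond => // r [+ _]; rewrite /= in_itv /= lee_fin => /andP[sr rs'].
    - by apply: G_ge0; [exact: le_lt_trans sr|exact: le_trans s'T].
    - exact: cG.
  rewrite -lee_fin; apply: (le_trans low).
  have fin : (\int[lebesgue_measure]_(r in `]s, s']%classic `\` N2) (G r)%:E)%E \is a fin_num.
    by move: e2; case: (\int[_]_(r in _) _)%E.
  move: e2; rewrite -(fineK fin) -EFinD => -[e2].
  by rewrite lee_fin; lra.
have V0 : V 0 = heat_value T a.
  have [N [_ _ _]] := key 0 (lexx 0) (ltW T0).
  by rewrite set_itvoc0 set0D integral_set0 => -[] /eqP; rewrite eq_sym subr_eq0 => /eqP.
rewrite -V0.
have Vnd s s' : 0 <= s -> s <= s' -> s' <= T -> V s <= V s'.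
  move=> s0 ss' s'T; rewrite -subr_ge0 -(mulr0 (s' - s)).
  apply: incr => // r sr rs'; apply: G_ge0; last exact: le_trans s'T.
  exact: le_lt_trans sr.
have V_ge0 s : 0 <= s -> s <= T -> 0 <= V s.
  by move=> s0 sT; apply: le_trans (Vnd 0 s _ _ _); rewrite // V0 ltW.
apply: lifetime_le_tail_integral => //; first by rewrite V0.
move=> s s' s0 ss' s'T; apply: incr => //.
  by apply: f0; apply: V_ge0 => //; exact: le_trans s'T.
move=> r sr rs'; apply: le_trans (G_ge r _ _).
- apply: f_nd; first by apply: V_ge0 => //; exact: le_trans s'T.
  by apply: Vnd => //; [exact: ltW|exact: le_trans s'T].
- exact: le_lt_trans sr.
- exact: le_trans s'T.
Qed.

End HeatValue.

(** * Nonexistence of global solutions *)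

(** Room for the loss in the heat kernel bound: at time [n ^ (2 l)] the bound is
    [n ^ (- (l + 1) theta)] rather than [n ^ (- l theta)]. *)
Lemma exponent_choice (R : realType) (q : R) : 0 < q -> q < 2 ->
  exists2 l : nat, (0 < l)%N & l.+1%:R * q < 2 * l%:R.
Proof.
move=> q0 q2; pose l := (Num.bound (q / (2 - q))).+1.
have d0 : 0 < 2 - q by rewrite subr_gt0.
have hl : q / (2 - q) < l%:R.
  apply: lt_trans (archi_boundP _) _; last by rewrite ltr_nat.
  by rewrite divr_ge0// ltW.
exists l => //; move: hl; rewrite ltr_pdivrMr// -natr1; lra.
Qed.

Lemma near_powR_gt (R : realType) (K e : R) : 0 < e ->
  \forall n \near \oo, K < n%:R `^ e.
Proof.
move=> e0; near=> n.
have nK : (`|K| + 1) `^ e^-1 < n%:R by near: n; exact: nbhs_infty_gtr.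
have K1 : 0 < `|K| + 1 by rewrite ltr_wpDl.
apply: (@lt_trans _ _ (`|K| + 1)); first by rewrite (le_lt_trans (ler_norm K))// ltrDl.
rewrite -[ltLHS](_ : ((`|K| + 1) `^ e^-1) `^ e = `|K| + 1).
  by apply: gt0_ltr_powR => //; rewrite nnegrE ?powR_ge0.
by rewrite -powRrM mulVf ?gt_eqF// powRr1// ltW.
Unshelve. all: by end_near. Qed.

Theorem theorem5p5 (R : realType) (X : countType) (m : X -> {posnum R})
    (b : graph R X) (theta p : R) (p1 : 1 <= p) (f : R -> R) (kappa gamma : R) :
  locally_finite b ->
  connected_graph b ->
  0 < inf [set (m x)%:num | x in [set: X]] ->
  (exists C : R, forall x, deg b m x <= C) ->
  0 < theta ->
  polynomial_growth b m theta ->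
  (forall s, 0 <= s -> 0 <= f s) ->
  convex_function (`[0, +oo[%classic : set R^o) f ->
  {within `[0, +oo[, continuous f} ->
  f 0 = 0 ->
  (forall s, 0 < s -> 0 < f s) ->
  (tail_integral f 1 < +oo)%E ->
  0 < kappa ->
  0 < gamma ->
  (\forall t \near +oo, (tail_integral f t^-1 <= (kappa * t `^ gamma)%:E)%E) ->
  theta * gamma < 2 ->
  forall a : ellp m p1,
    (forall x, 0 <= a x) ->
    a != 0 ->
    ~ exists u : R -> ellp m p1, global_mild_solution b f a u.
Proof.
move=> lf conn m_inf [C1 degC1] theta0 growth f0 cf _ f00 fpos _ kappa0 gamma0
  tail tg2 a a0 a_neq0 [u sol].
have [ o ao] : exists o, 0 < a o.
  apply: contrapT => /forallNP ha; move/negP: a_neq0; apply; apply/eqP/val_inj.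
  apply/funext => x /=; apply/eqP; rewrite eq_le a0 andbT leNgt.
  by apply/negP; exact: ha.
pose c0 := inf [set (m x)%:num | x in [set: X]].
have m_ge x : c0 <= (m x)%:num.
  apply: inf_lbound; last by exists x.
  by exists 0 => _ [y _ <-].
pose C := 2 * (`|C1| + 1).
have C0 : 0 < C by rewrite mulr_gt0// ltr_wpDl.
have degC x : deg b m x <= C / 2.
  apply: (le_trans (degC1 x)); apply: (le_trans (ler_norm _)).
  by rewrite /C mulrAC mulfV// mul1r lerDl.
have tg0 : 0 < theta * gamma by rewrite mulr_gt0.
have [l l0 hl] := exponent_choice tg0 tg2.
pose s := (Num.bound (2 * l%:R * theta)).
have hs : 2 * l%:R * theta < s%:R.
  by apply: archi_boundP; rewrite !mulr_ge0// ltW.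
have [c1 c1_gt0 kern] := walk_kernel_ge lf C0 degC conn theta0 growth o l0 hs.
pose c2 := a o * (m o)%:num * c1 / 2.
have c2_gt0 : 0 < c2 by rewrite divr_gt0// !mulr_gt0.
pose beta := l.+1%:R * theta.
have beta0 : 0 < beta by rewrite mulr_gt0.
(* The time is [N / C], so that the Poisson distribution has mean [N = n ^ (2 l)]. *)
have value_ge : \forall n \near \oo,
    c2 / n%:R `^ beta <= heat_value b C o ((n ^ (2 * l))%:R / C) a.
  near=> n; have n0 : (0 < n)%N by near: n; exact: nbhs_infty_gt.
  pose N := (n ^ (2 * l))%N; have N0 : (0 < N)%N by rewrite expn_gt0 n0.
  have kern_n : forall k, (k <= 4 * n ^ (2 * l))%N ->
      c1 / n%:R `^ beta <= walk_kernel m b C o k o.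
    by near: n; exact: kern.
  have CN : C * (N%:R / C) = N%:R by rewrite mulrCA mulfV ?mulr1// gt_eqF.
  rewrite /heat_value CN.
  have c_ge0 : 0 <= a o * (m o)%:num * (c1 / n%:R `^ beta).
    by rewrite !mulr_ge0 ?divr_ge0 ?powR_ge0// ltW.
  have zK := fun k => normr_iter_walk_le lf C0 degC k (ellp_sup_le m_inf m_ge a) o.
  have z_ge := fun k => iter_walk_ge_kernel lf C0 degC o k a0.
  apply: le_trans (poisson_avg_ge (M := (4 * N)%N) (ler0n _ N) c_ge0 _ zK _).
  - have half : expR N%:R / 2 ^+ (4 * N) <= 2^-1 :> R.
      rewrite ler_pdivrMr ?exprn_gt0// -[N%:R]mulr1 expRM_natl exprM.
      apply: (@le_trans _ _ (4 ^+ N)).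
        by rewrite lerXn2r ?nnegrE ?expR_ge0// expR1_le4.
      have -> : (2 ^+ 4 : R) = 4 * 4 by ring.
      rewrite exprMn mulrA ler_peMl ?exprn_ge0// mulrC ler_pdivlMr// mul1r.
      case: (N) N0 => // q _; rewrite exprS.
      have : 1 <= 4 ^+ q :> R by rewrite exprn_ege1//; lra.
      lra.
    rewrite /c2; set w := c1 / _ in c_ge0 *.
    have -> : a o * (m o)%:num * c1 / 2 / n%:R `^ beta = a o * (m o)%:num * w / 2.
      by rewrite /w; ring.
    by apply: ler_wpM2l => //; lra.
  - move=> k; apply: le_trans (z_ge k).
    by rewrite !mulr_ge0// walk_kernel_ge0.
  - move=> k kN; apply: le_trans (z_ge k).
    by rewrite ler_wpM2l ?mulr_ge0//; exact: kern_n.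
(* From here on, [T <= F (exp (- T L) a o) <= kappa (n ^ beta / c2) ^ gamma] is
   compared with [T = n ^ (2 l) / C], where [beta * gamma < 2 l]. *)
have [t0 [_ tailP]] := tail.
pose K := C * (kappa * c2 `^ (- gamma)).
pose delta := 2 * l%:R - beta * gamma.
have delta0 : 0 < delta.
  by rewrite subr_gt0 /beta -mulrA.
have big_n : \forall n \near \oo, K < n%:R `^ delta by exact: near_powR_gt.
have big_t : \forall n \near \oo, `|t0| * c2 < n%:R `^ beta by exact: near_powR_gt.
suff : \forall n \near \oo, False by case=> n _ /(_ n (leqnn n)).
near=> n.
have n0 : (0 < n)%N by near: n; exact: nbhs_infty_gt.
have nR : 0 < n%:R :> R by rewrite ltr0n.
have : c2 / n%:R `^ beta <= heat_value b C o ((n ^ (2 * l))%:R / C) a.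
  by near: n; exact: value_ge.
pose N := (n ^ (2 * l))%N; pose T := N%:R / C; rewrite -/N -/T => value_n.
have T0 : 0 < T by rewrite divr_gt0// ltr0n expn_gt0 n0.
have nb : 0 < n%:R `^ beta by rewrite powR_gt0.
have low_gt0 : 0 < c2 / n%:R `^ beta by rewrite divr_gt0.
have life := mild_solution_lifetime lf C0 degC m_inf m_ge cf f0 f00 fpos sol T0
  (lt_le_trans low_gt0 value_n).
have anti := tail_integral_antitone fpos (convex_nondecreasing cf f0 f00)
  low_gt0 value_n.
have t_big : t0 < n%:R `^ beta / c2.
  rewrite ltr_pdivlMr//; apply: le_lt_trans (_ : `|t0| * c2 < _).
    by rewrite ler_pM2r// ler_norm.
  by near: n; exact: big_t.
have := tailP _ t_big; rewrite invf_div => upper.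
have : T <= kappa * (n%:R `^ beta / c2) `^ gamma.
  by rewrite -lee_fin; apply: le_trans life (le_trans anti upper).
rewrite powRM ?invr_ge0 ?(ltW c2_gt0) ?powR_ge0// -powRrM.
rewrite -powR_inv1 ?(ltW c2_gt0)// -powRrM mulN1r.
rewrite /T ler_pdivrMr//.
have -> : N%:R = n%:R `^ delta * n%:R `^ (beta * gamma) :> R.
  rewrite -powRD; last by apply/implyP => _; rewrite gt_eqF.
  by rewrite /delta subrK /N natrX -powR_mulrn// natrM.
have -> : kappa * (n%:R `^ (beta * gamma) * c2 `^ (- gamma)) * C
    = K * n%:R `^ (beta * gamma) by rewrite /K; ring.
rewrite ler_pM2r ?powR_gt0// leNgt => /negP; apply.
by near: n; exact: big_n.
Unshelve. all: by end_near. Qed.
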